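(* Let $k$ be a field of characteristic $p>0$ which has infinitely many (non-equivalent) discrete valuations. Let $S$ be a finite set of non-equivalent discrete valuations of $k$; for each $v\in S$ let $k_v$ be the completion of $k$ at $v$ and fix an embedding $\phi_v:\mathrm{Gal}(k_v)\to\mathrm{Gal}(k)$, and let $\phi_S=\{\phi_v\}_{v\in S}$. Then every finite $p$-embedding problem for $\mathrm{Gal}(k)$ is properly $\phi_S$-solvable. Explicitly: for every finite embedding problem $(\alpha:\mathrm{Gal}(k)\to G,\ f:\Gamma\to G)$ whose kernel $N=\ker f$ is a $p$-group, and every collection $\{\beta_v\}_{v\in S}$ of weak solutions of the pullback embedding problems $\phi_v^*(\mathcal{E})$, there exist a surjective homomorphism $\beta:\mathrm{Gal}(k)\to\Gamma$ with $f\beta=\alpha$ and elements $n_v\in N$ such that $\beta\circ\phi_v=\mathrm{inn}(n_v)\circ\beta_v$ for all $v\in S$.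
   Context: All homomorphisms of profinite groups are continuous. An embedding problem $\mathcal{E}$ for a profinite group $\Pi$ consists of profinite groups $\Gamma,G$ and epimorphisms $\alpha:\Pi\to G$, $f:\Gamma\to G$; it is finite if $\Gamma$ is finite, its kernel is $N=\ker f$, and it is a $p$-embedding problem if $N$ is a $p$-group. A weak solution is a homomorphism $\beta:\Pi\to\Gamma$ with $f\beta=\alpha$; a proper solution is a surjective weak solution. Given a homomorphism $\phi_1:\Pi_1\to\Pi$, the pullback $\phi_1^*(\mathcal{E})$ is the embedding problem for $\Pi_1$ given by $\alpha\phi_1:\Pi_1\to G_1$ and $f|_{\Gamma_1}:\Gamma_1\to G_1$, where $G_1=\alpha\phi_1(\Pi_1)$ and $\Gamma_1=f^{-1}(G_1)$. For a family $\phi=\{\phi_j:\Pi_j\to\Pi\}_{j\in J}$, $\mathcal{E}$ is properly $\phi$-solvable if for every collection $\{\beta_j\}$ of weak solutions of the $\phi_j^*(\mathcal{E})$ there is a proper solution $\beta$ of $\mathcal{E}$ and elements $n_j\in N$ with $\beta\phi_j=\mathrm{inn}(n_j)\circ\beta_j$ for all $j$, where $\mathrm{inn}(n)$ is left conjugation by $n$. *)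

(* Defs.v *)
From HB Require Import structures.
From mathcomp Require Import all_boot all_order all_fingroup all_algebra.
From mathcomp Require Import all_solvable separable.
From mathcomp Require Import mathcomp_extra boolp classical_sets functions.
From mathcomp Require Import topology.

Set Implicit Arguments.
Unset Strict Implicit.
Unset Printing Implicit Defensive.

Import Order.TTheory GRing.Theory Num.Theory.
Local Open Scope classical_set_scope.
Local Open Scope ring_scope.

(* Normalized discrete valuations: the value v 0 is junk (it stands for +oo). *)
Record dvaluation (k : fieldType) := DValuation {
  dval :> k -> int;
  dvalM : forall x y, x != 0 -> y != 0 -> dval (x * y) = dval x + dval y;
  dvalD : forall x y, x != 0 -> y != 0 -> x + y != 0 ->
    Num.min (dval x) (dval y) <= dval (x + y);
  dval_surj : forall n : int, exists2 x, x != 0 & dval x = n }.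

(* Equality of the valuation rings. *)
Definition dval_equiv (k : fieldType) (v w : dvaluation k) : Prop :=
  forall x : k, x != 0 -> (0 <= v x) = (0 <= w x).

Definition infinitely_many_dvaluations (k : fieldType) : Prop :=
  exists u : nat -> dvaluation k,
    forall m n : nat, m <> n -> ~ dval_equiv (u m) (u n).

(* v x >= n, with the convention v 0 = +oo. *)
Definition dval_ge (k : fieldType) (v : dvaluation k) (n : int) (x : k) : Prop :=
  x = 0 \/ n <= v x.

Definition dval_cauchy (k : fieldType) (v : dvaluation k) (u : nat -> k) : Prop :=
  forall n : int, exists M : nat, forall i j : nat,
    (M <= i)%N -> (M <= j)%N -> dval_ge v n (u i - u j).

Definition dval_cvg (k : fieldType) (v : dvaluation k) (u : nat -> k) (l : k) : Prop :=
  forall n : int, exists M : nat, forall i : nat,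
    (M <= i)%N -> dval_ge v n (u i - l).

Record completion (k : fieldType) (v : dvaluation k) := Completion {
  compl_field :> fieldType;
  compl_in : {rmorphism k -> compl_field};
  compl_val : dvaluation compl_field;
  compl_valE : forall x : k, x != 0 -> compl_val (compl_in x) = v x;
  compl_dense : forall (y : compl_field) (n : int),
    exists x : k, dval_ge compl_val n (compl_in x - y);
  compl_complete : forall u : nat -> compl_field,
    dval_cauchy compl_val u -> exists l, dval_cvg compl_val u l }.

Record sepClosure (k : fieldType) := SepClosure {
  sepc_field :> fieldType;
  sepc_in : {rmorphism k -> sepc_field};
  sepc_separable : forall x : sepc_field, exists2 q : {poly k},
    separable_poly q & root (map_poly sepc_in q) x;
  sepc_closed : forall q : {poly sepc_field},
    separable_poly q -> (1 < size q)%N -> exists x, root q x }.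

HB.mixin Record isProfinite G & monoid.Group G & Topological G := {
  profinite_mul_continuous : continuous (fun z : G * G => (z.1 * z.2)%g);
  profinite_inv_continuous : continuous (fun x : G => (x^-1)%g);
  profinite_compact : compact [set: G];
  profinite_hausdorff : hausdorff_space G;
  profinite_totally_disconnected : totally_disconnected [set: G] }.

#[short(type="profiniteGroupType")]
HB.structure Definition ProfiniteGroup :=
  { G of monoid.Group G & Topological G & isProfinite G }.

Section AbsoluteGaloisGroup.
Variables (k : fieldType) (E : sepClosure k).

Record Gal := MkGal {
  gal_fun :> E -> E;
  galD : {morph gal_fun : x y / x + y};
  galM : {morph gal_fun : x y / x * y};
  gal_bij : bijective gal_fun;
  gal_fix : forall a : k, gal_fun (sepc_in E a) = sepc_in E a }.

Implicit Types s t : Gal.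

Lemma galP s t : s =1 t -> s = t.
Proof.
case: s t => [f fD fM fB fF] [g gD gM gB gF] /= /funext fg.
by case: _ / fg in gD gM gB gF *; congr MkGal; exact: Prop_irrelevance.
Qed.

HB.instance Definition _ := gen_eqMixin Gal.
HB.instance Definition _ := gen_choiceMixin Gal.

Definition gal_one : Gal.
Proof. by exists id => //; exists id. Defined.

Definition gal_mul s t : Gal.
Proof.
exists (s \o t).
- by move=> x y /=; rewrite !galD.
- by move=> x y /=; rewrite !galM.
- exact: bij_comp (gal_bij s) (gal_bij t).
- by move=> a /=; rewrite !gal_fix.
Defined.

Lemma gal_inv_ex s : exists t, cancel s t /\ cancel t s.
Proof.
have [g sK gK] := gal_bij s.
have gP : [/\ {morph g : x y / x + y}, {morph g : x y / x * y},
    bijective g & forall a : k, g (sepc_in E a) = sepc_in E a].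
  split; [| |by exists s|] => [x y|x y|a]; apply: (can_inj sK).
  - by rewrite galD !gK.
  - by rewrite galM !gK.
  - by rewrite gK gal_fix.
by case: gP => gD gM gB gF; exists (MkGal gD gM gB gF).
Qed.

Definition gal_inv s : Gal := sval (cid (gal_inv_ex s)).

Lemma gal_funK s : cancel s (gal_inv s).
Proof. by rewrite /gal_inv; case: cid => t []. Qed.

Lemma gal_invK s : cancel (gal_inv s) s.
Proof. by rewrite /gal_inv; case: cid => t []. Qed.

Fact gal_mulA : associative gal_mul.
Proof. by move=> r s t; exact: galP. Qed.
Fact gal_mul1 : left_id gal_one gal_mul.
Proof. by move=> s; exact: galP. Qed.
Fact gal_mulr1 : right_id gal_one gal_mul.
Proof. by move=> s; exact: galP. Qed.
Fact gal_mulV : left_inverse gal_one gal_inv gal_mul.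
Proof. by move=> s; apply: galP => x; exact: gal_funK. Qed.
Fact gal_mulrV : right_inverse gal_one gal_inv gal_mul.
Proof. by move=> s; apply: galP => x; exact: gal_invK. Qed.

HB.instance Definition _ :=
  isGroup.Build Gal gal_mulA gal_mul1 gal_mulr1 gal_mulV gal_mulrV.

(* The Krull topology: the automorphisms agreeing with s on a finite set of
   elements form a basic neighbourhood of s. *)
Definition krull_open : set (set Gal) := [set U | forall s, U s ->
  exists r : seq E, forall t, {in r, s =1 t} -> U t].

Fact krull_openT : krull_open setT.
Proof. by move=> s _; exists [::]. Qed.

Fact krull_openI : setI_closed krull_open.
Proof.
move=> A B oA oB s [/oA[r rA] /oB[q qB]]; exists (r ++ q) => t st; split.
  by apply: rA => x xr; apply: st; rewrite mem_cat xr.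
by apply: qB => x xr; apply: st; rewrite mem_cat xr orbT.
Qed.

Fact krull_open_bigU (I : Type) (f : I -> set Gal) :
  (forall i, krull_open (f i)) -> krull_open (\bigcup_i f i).
Proof.
by move=> fo s [i _ /fo[r rf]]; exists r => t /rf; exists i.
Qed.

HB.instance Definition _ :=
  isOpenTopological.Build Gal krull_openT krull_openI krull_open_bigU.

Lemma nbhs_krullP s (A : set Gal) :
  nbhs s A <-> exists r : seq E, forall t, {in r, s =1 t} -> A t.
Proof.
split=> [[B [oB Bs BA]]|[r rA]].
  by have [r rB] := oB s Bs; exists r => t /rB/BA.
exists [set t | {in r, s =1 t}]; split=> //.
by move=> t st; exists r => t' tt' x xr; rewrite st // tt'.
Qed.

Fact gal_mul_continuous : continuous (fun z : Gal * Gal => (z.1 * z.2)%g).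
Proof.
move=> [s t] A /nbhs_krullP[r rA].
exists ([set s' : Gal | {in map t r, s =1 s'}], [set t' : Gal | {in r, t =1 t'}]).
  by split; apply/nbhs_krullP; [exists (map t r)|exists r].
move=> [s' t'] [/= ss' tt']; apply: rA => x xr /=.
by rewrite -[RHS]/(s' (t' x)) -tt' // -ss' ?map_f.
Qed.

Fact gal_inv_continuous : continuous (fun s : Gal => (s^-1)%g).
Proof.
move=> s A /nbhs_krullP[r rA]; apply/nbhs_krullP.
exists (map (gal_inv s) r) => t st; apply: rA => x xr.
apply: (can_inj (gal_funK t)); rewrite [RHS]gal_invK.
by rewrite -[LHS]/(t (gal_inv s x)) -st ?map_f // gal_invK.
Qed.

Fact gal_clopen (s : Gal) (x : E) : clopen [set t : Gal | s x = t x].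
Proof.
split; last rewrite -[X in closed X]setCK; last apply: open_closedC.
all: by move=> t tx; exists [:: x] => t' tt' /=; rewrite -tt' ?mem_head.
Qed.

Fact gal_hausdorff : hausdorff_space Gal.
Proof.
move=> s t st; apply: galP => x.
have nx (r : Gal) : nbhs r [set t' : Gal | r x = t' x].
  by apply/nbhs_krullP; exists [:: x] => t' rt' /=; rewrite -rt' ?mem_head.
have [t' /= [st' tt']] := st _ _ (nx s) (nx t).
by rewrite st' tt'.
Qed.

Fact gal_totally_disconnected : totally_disconnected [set: Gal].
Proof.
apply: zero_dimension_totally_disconnected => s t st.
have [x sx] : exists x, s x <> t x.
  by apply: contrapT => /forallNP H; move/eqP: st; apply; apply: galP => x; exact: contrapT.
by exists [set t' : Gal | s x = t' x]; split=> //; exact: gal_clopen.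
Qed.

Lemma finite_roots (q : {poly E}) : q != 0 ->
  exists rs : seq E, forall y, root q y -> y \in rs.
Proof.
have [n] := ubnP (size q); elim: n q => // n IHn q szq q0.
have [[y qy]|noroot] := pselect (exists y, root q y); last first.
  by exists [::] => y qy; case: noroot; exists y.
have /factor_theorem[q' Dq] := qy.
have q'0 : q' != 0 by apply: contraNneq q0 => q'0; rewrite Dq q'0 mul0r.
have [|rs rsP] := IHn q' _ q'0.
  by move: szq; rewrite Dq size_Mmonic ?monicXsubC // size_XsubC addn2.
exists (y :: rs) => z; rewrite Dq rootM root_XsubC inE orbC.
by case/orP=> [->//|/rsP ->]; rewrite orbT.
Qed.

Lemma gal_root (q : {poly k}) s x :
  root (map_poly (sepc_in E) q) x -> root (map_poly (sepc_in E) q) (s x).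
Proof.
have s0 : s 0 = 0 by apply: (addrI (s 0)); rewrite -galD !addr0.
have s1 : s 1 = 1 by rewrite -(rmorph1 (sepc_in E)) gal_fix.
rewrite /root !horner_poly => /eqP qx0; apply/eqP.
transitivity (s 0); last exact: s0.
rewrite -[in RHS]qx0.
rewrite (big_morph s (@galD s) s0); apply: eq_bigr => i _.
by rewrite galM gal_fix; congr (_ * _); elim: (val i) => [|j IH];
  rewrite ?expr0 // !exprS galM IH.
Qed.

Lemma gal_orbit_finite x :
  exists rs : seq E, forall s, s x \in rs /\ gal_inv s x \in rs.
Proof.
have [q sq qx] := sepc_separable x.
have [|rs rsP] := @finite_roots (map_poly (sepc_in E) q).
  rewrite map_poly_eq0; apply: contraTneq sq => ->.
  by rewrite separable_poly.unlock deriv0 coprime0p -size_poly_eq1 size_poly0.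
by exists rs => s; split; apply: rsP; exact: gal_root.
Qed.

Lemma ultra_fiber (F : set_system Gal) (g : Gal -> E) (rs : seq E) :
  UltraFilter F -> (forall s, g s \in rs) -> exists y, F [set s | g s = y].
Proof.
move=> FU grs; have : F [set s | g s \in rs] by apply: filterS filterT => s _ /=.
elim: rs {grs} => [|y rs IH] Frs.
  by case: (filter_ex Frs).
have [|Fy] := in_ultra_setVsetC [set s | g s = y] FU; first by exists y.
apply: IH; apply: filterS (filterI Frs Fy) => s [/= + /= gy].
by rewrite inE => /orP[/eqP|].
Qed.

Fact gal_compact : compact [set: Gal].
Proof.
rewrite compact_ultra => F FU _.
have /choice[g gP] : forall x, exists y, F [set s : Gal | s x = y].
  move=> x; have [rs rsP] := gal_orbit_finite x.
  by apply: (@ultra_fiber F (fun s => s x) rs) => // s; have [] := rsP s.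
have /choice[h hP] : forall x, exists y, F [set s : Gal | gal_inv s x = y].
  move=> x; have [rs rsP] := gal_orbit_finite x.
  by apply: (@ultra_fiber F (fun s => gal_inv s x) rs) => // s; have [] := rsP s.
have gD : {morph g : x y / x + y}.
  move=> x y; have [s [[/= <- <-] <-]] :=
    filter_ex (filterI (filterI (gP x) (gP y)) (gP (x + y))).
  exact: galD.
have gM : {morph g : x y / x * y}.
  move=> x y; have [s [[/= <- <-] <-]] :=
    filter_ex (filterI (filterI (gP x) (gP y)) (gP (x * y))).
  exact: galM.
have gB : bijective g.
  exists h => x.
    have [s [/= sx hx]] := filter_ex (filterI (gP x) (hP (g x))).
    by rewrite -hx -sx gal_funK.
  have [s [/= hx sx]] := filter_ex (filterI (hP x) (gP (h x))).
  by rewrite -sx -hx gal_invK.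
have gF a : g (sepc_in E a) = sepc_in E a.
  by have [s /= <-] := filter_ex (gP (sepc_in E a)); exact: gal_fix.
exists (MkGal gD gM gB gF); split=> // A /nbhs_krullP[r rA].
suff : F [set s : Gal | {in r, g =1 s}] by apply: filterS => s /rA.
elim: r {rA} => [|x r IH]; first by apply: filterS filterT => s _.
apply: filterS (filterI (gP x) IH) => s [/= sx sr] y.
by rewrite inE => /predU1P[->|/sr].
Qed.

HB.instance Definition _ := isProfinite.Build Gal gal_mul_continuous
  gal_inv_continuous gal_compact gal_hausdorff gal_totally_disconnected.

End AbsoluteGaloisGroup.

Record profiniteHom (Pi' Pi : profiniteGroupType) := ProfiniteHom {
  phom :> Pi' -> Pi;
  phomM : {morph phom : x y / (x * y)%g};
  phom_continuous : continuous phom }.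

Lemma sepClosure_split (k : fieldType) (E : sepClosure k) (q : {poly E}) :
  separable_poly q ->
  exists rs : seq E, q %= \prod_(r <- rs) ('X - r%:P).
Proof.
have [n] := ubnP (size q); elim: n q => // n IHn q szq sq.
have [sz1|] := ltnP 1 (size q); last first.
  rewrite leq_eqVlt ltnS leqn0 size_poly_eq0 => /orP[sz1|/eqP q0].
    by exists [::]; rewrite big_nil -size_poly_eq1.
  by move: sq; rewrite q0 separable_poly.unlock deriv0 coprime0p -size_poly_eq1 size_poly0.
have [x /factor_theorem[q' Dq]] := sepc_closed sq sz1.
have [||rs rsP] := IHn q'.
- have q'0 : q' != 0.
    by apply: contraTneq sz1 => q'0; rewrite Dq q'0 mul0r size_poly0.
  by move: szq; rewrite Dq size_Mmonic ?monicXsubC // size_XsubC addn2.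
- by apply: dvdp_separable sq; rewrite Dq dvdp_mulr.
by exists (x :: rs); rewrite big_cons Dq mulrC eqp_mull.
Qed.

(* Every k-embedding iota of the separable closures induces a (unique)
   restriction map between the absolute Galois groups. *)
Lemma gal_restriction_ex (k K : fieldType) (i : {rmorphism k -> K})
    (E : sepClosure k) (F : sepClosure K) (iota : {rmorphism E -> F}) :
  (forall a : k, iota (sepc_in E a) = sepc_in F (i a)) ->
  exists phi : profiniteHom (Gal F) (Gal E),
    forall (s : Gal F) (x : E), iota (phi s x) = s (iota x).
Proof.
move=> iotaE.
have im (s : Gal F) x : exists y, iota y = s (iota x).
  have [q sq qx] := sepc_separable x.
  have mapq : map_poly iota (map_poly (sepc_in E) q) =
      map_poly (sepc_in F) (map_poly i q).
    by rewrite -!map_poly_comp; apply: eq_map_poly => a /=.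
  have : root (map_poly (sepc_in F) (map_poly i q)) (s (iota x)).
    by apply: gal_root; rewrite -mapq fmorph_root.
  have [|rs rsP] := @sepClosure_split _ E (map_poly (sepc_in E) q).
    by rewrite separable_map.
  have := rsP; rewrite -(eqp_map iota) => /eqp_root; rewrite mapq => ->.
  rewrite rmorph_prod; under eq_bigr do rewrite rmorphB /= map_polyX map_polyC /=.
  elim: {rsP} rs => [|r rs IH]; first by rewrite big_nil (negPf (root1 _)).
  by rewrite big_cons rootM root_XsubC => /orP[/eqP ->|//]; exists r.
have /choice[f fP] : forall s : Gal F, exists t : Gal E,
    forall x, iota (t x) = s (iota x).
  move=> s; have /choice[g gP] := im s; have /choice[h hP] := im (gal_inv s).
  have gD : {morph g : x y / x + y}.
    by move=> x y; apply: (fmorph_inj iota); rewrite rmorphD !gP rmorphD galD.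
  have gM : {morph g : x y / x * y}.
    by move=> x y; apply: (fmorph_inj iota); rewrite rmorphM !gP rmorphM galM.
  have gB : bijective g.
    by exists h => x; apply: (fmorph_inj iota); rewrite ?(hP, gP) ?gal_funK ?gal_invK.
  have gF a : g (sepc_in E a) = sepc_in E a.
    by apply: (fmorph_inj iota); rewrite gP iotaE gal_fix.
  by exists (MkGal gD gM gB gF).
have fM : {morph f : s t / (s * t)%g}.
  move=> s t; apply: galP => x; apply: (fmorph_inj iota).
  by rewrite fP -[(s * t)%g _]/(s (t _)) -[(f s * f t)%g _]/(f s (f t _)) !fP.
have fC : continuous f.
  move=> s A /nbhs_krullP[r rA]; apply/nbhs_krullP; exists (map iota r).
  move=> t st; apply: rA => x xr; apply: (fmorph_inj iota).
  by rewrite !fP st ?map_f.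
by exists (ProfiniteHom fM fC).
Qed.

Local Open Scope group_scope.

(* Since f is onto, G is finite along with Gamma, and a finite profinite group
   is discrete: continuity is for the discrete topology. Gamma and G are
   subgroups of ambient finite groups so that the restriction f^-1(G1) -> G1 is
   again of this form. *)
Record finEmbeddingProblem (Pi : profiniteGroupType) := FinEmbeddingProblem {
  ep_gT : finGroupType;
  ep_hT : finGroupType;
  ep_Gamma : {group ep_gT};
  ep_G : {group ep_hT};
  ep_alpha : Pi -> ep_hT;
  ep_f : {morphism ep_Gamma >-> ep_hT};
  ep_alphaM : {morph ep_alpha : x y / x * y};
  ep_alpha_continuous : continuous (ep_alpha : Pi -> discrete_topology ep_hT);
  ep_alpha_onto : range ep_alpha = [set` ep_G];
  ep_f_onto : ep_f @* ep_Gamma = ep_G }.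

Definition ep_ker (Pi : profiniteGroupType) (E : finEmbeddingProblem Pi) :
  {group ep_gT E} := [group of 'ker (ep_f E)].

Section Pullback.
Variables (Pi' Pi : profiniteGroupType) (phi : profiniteHom Pi' Pi).
Variable E : finEmbeddingProblem Pi.

Definition pullback_alpha (x : Pi') : ep_hT E := ep_alpha E (phi x).

Fact pullback_alphaM : {morph pullback_alpha : x y / x * y}.
Proof. by move=> x y; rewrite /pullback_alpha phomM ep_alphaM. Qed.

Fact pullback_alpha_continuous :
  continuous (pullback_alpha : Pi' -> discrete_topology (ep_hT E)).
Proof.
move=> x; apply: (@continuous_comp _ _ (discrete_topology (ep_hT E)) phi).
  exact: phom_continuous.
exact: ep_alpha_continuous.
Qed.

Definition pullback_Gset : {set ep_hT E} :=
  [set y | y \in range pullback_alpha]%SET.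

Lemma in_pullback_G y : y \in pullback_Gset <-> exists x, pullback_alpha x = y.
Proof.
rewrite finset.in_set; split=> [/set_mem[x _ <-]|[x <-]]; first by exists x.
by apply/mem_set; exists x.
Qed.

Fact pullback_G_group_set : group_set pullback_Gset.
Proof.
apply/group_setP; split=> [|_ _ /in_pullback_G[x <-] /in_pullback_G[y <-]].
  apply/in_pullback_G; exists 1.
  by apply: (mulgI (pullback_alpha 1)); rewrite -pullback_alphaM !mulg1.
by apply/in_pullback_G; exists (x * y); rewrite pullback_alphaM.
Qed.

Definition pullback_G : {group ep_hT E} := Group pullback_G_group_set.

Definition pullback_Gamma : {group ep_gT E} :=
  [group of ep_f E @*^-1 pullback_G].

Fact pullback_Gamma_sub : pullback_Gamma \subset ep_Gamma E.
Proof. exact: subsetIl. Qed.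

Definition pullback_f : {morphism pullback_Gamma >-> ep_hT E} :=
  [morphism of restrm pullback_Gamma_sub (ep_f E)].

Fact pullback_alpha_onto : range pullback_alpha = [set` pullback_G].
Proof.
apply/seteqP; split=> [y [x _ <-]|y /in_pullback_G[x <-]]; last by exists x.
by apply/in_pullback_G; exists x.
Qed.

Fact pullback_f_onto : pullback_f @* pullback_Gamma = pullback_G.
Proof.
rewrite morphim_restrm finset.setIid morphpreK // ep_f_onto.
apply/fintype.subsetP => y /in_pullback_G[x <-].
have : range (ep_alpha E) (pullback_alpha x) by exists (phi x).
by rewrite ep_alpha_onto.
Qed.

Definition pullback : finEmbeddingProblem Pi' :=
  FinEmbeddingProblem pullback_alphaM pullback_alpha_continuous
    pullback_alpha_onto pullback_f_onto.

End Pullback.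

Definition weak_solution (Pi : profiniteGroupType) (E : finEmbeddingProblem Pi)
    (beta : Pi -> ep_gT E) : Prop :=
  [/\ {morph beta : x y / x * y},
      continuous (beta : Pi -> discrete_topology (ep_gT E)),
      forall x, beta x \in ep_Gamma E &
      forall x, ep_f E (beta x) = ep_alpha E x].

Definition proper_solution (Pi : profiniteGroupType) (E : finEmbeddingProblem Pi)
    (beta : Pi -> ep_gT E) : Prop :=
  weak_solution beta /\ forall y, y \in ep_Gamma E -> exists x, beta x = y.

(* inn(n) is the left conjugation x |-> n x n^-1, that is x ^ n^-1. *)
Definition properly_solvable (J : Type) (Pi_ : J -> profiniteGroupType)
    (Pi : profiniteGroupType) (phi : forall j, profiniteHom (Pi_ j) Pi)
    (E : finEmbeddingProblem Pi) : Prop :=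
  forall beta_ : forall j, Pi_ j -> ep_gT E,
    (forall j, @weak_solution (Pi_ j) (pullback (phi j) E) (beta_ j)) ->
  exists (beta : Pi -> ep_gT E) (n : J -> ep_gT E),
    [/\ proper_solution beta,
        forall j, n j \in ep_ker E &
        forall j x, beta (phi j x) = n j * beta_ j x * (n j)^-1].

(* Main.v *)
(** Filtering the kernel by normal subgroups of Gamma reduces the theorem to a
    minimal normal kernel M = 'F_p^n.  Put A = M (x) ksep, with the twisted
    action of Gal(k); a finite averaging argument kills its H^1 and H^2, and
    Galois descent gives an invariant basis P of A.  The exact sequence
    0 -> M -> A -> A -> 0 defined by Frob - 1 then parametrizes the weak
    solutions by vectors c over k: solve Frob w - w = a0 + c P.  A prescribed
    local solution at v corresponds to a vector d over k_v, and it is matched,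
    up to conjugation by M, as soon as c is v-adically close to d, because
    small vectors of A over k_v lie in the image of Frob - 1; weak
    approximation provides c.  Finally let c vary with a pole of large order
    prime to p at one more valuation: the solutions obtained are pairwise
    distinct, so there are infinitely many of them, whereas a solution that is
    not surjective is trivial on ker alpha, and there are finitely many of those. *)

Require Import Defs.
From HB Require Import structures.
From mathcomp Require Import all_boot all_order all_fingroup all_algebra.
From mathcomp Require Import all_solvable separable mxrepresentation mxabelem.
From mathcomp Require Import zify ring.
From mathcomp Require Import boolp classical_sets topology.

Set Implicit Arguments.
Unset Strict Implicit.
Unset Printing Implicit Defensive.

Import Order.TTheory GRing.Theory Num.Theory.
Local Open Scope ring_scope.

(** * The field fixed by the absolute Galois group *)

(** The untwisted model is k/(Frob - 1)k, which classifies homomorphisms to 'F_p. A nontrivial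
    action on M replaces Frob - 1 on vectors over k by y -> Frob y Phi - y, where Phi is the matrix
    of Frobenius in the basis P; the contraction near 0 and the pole argument must therefore absorb
    a matrix that mixes the coordinates. A nonsplit extension offers no base solution: its factor
    set C becomes, up to sign, the coboundary of a cochain b with values in A, and since Frobenius
    fixes C, Frob b - b is a cocycle, which a0 trivializes. Surjectivity is reached by counting
    because approximation controls only the local restrictions up to conjugacy, and these may all be
    trivial. Finite Galois extensions are nowhere formed: a finite set r of elements of E marks a
    finite level, and functions that depend only on the restriction to r are summed over coset
    representatives. *)

Section GaloisAction.
Variables (k : fieldType) (E : sepClosure k).
Implicit Types s t : Gal E.

Fact gal_zmod_morphism s : zmod_morphism s.
Proof.
have s0 : s 0 = 0 by apply: (addrI (s 0)); rewrite -galD !addr0.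
have sN x : s (- x) = - s x by apply/eqP; rewrite -addr_eq0 -galD addNr s0.
by move=> x y; rewrite galD sN.
Qed.

Fact gal_monoid_morphism s : monoid_morphism s.
Proof. by split; [rewrite -(rmorph1 (sepc_in E)) gal_fix|exact: galM]. Qed.

HB.instance Definition _ s := GRing.isZmodMorphism.Build E E s (gal_zmod_morphism s).
HB.instance Definition _ s := GRing.isMonoidMorphism.Build E E s (gal_monoid_morphism s).

Lemma gal_mulE s t x : (s * t)%g x = s (t x).
Proof. by []. Qed.

(* A partial k-embedding of E into itself is encoded by its graph. *)
Record partial_embedding (R : set (E * E)) : Prop := PartialEmbedding {
  pe_base : forall a, R (sepc_in E a, sepc_in E a);
  pe_sub : forall x y x' y', R (x, y) -> R (x', y') -> R (x - x', y - y');
  pe_mul : forall x y x' y', R (x, y) -> R (x', y') -> R (x * x', y * y');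
  pe_fun : forall y, R (0, y) -> y = 0 }.

Definition rel_poly (R : set (E * E)) (f g : {poly E}) :=
  forall i, R (f`_i, g`_i).

Section PartialEmbedding.
Variables (R : set (E * E)) (peR : partial_embedding R).

Lemma pe_0 : R (0, 0).
Proof. by have := pe_base peR 0; rewrite rmorph0. Qed.

Lemma pe_1 : R (1, 1).
Proof. by have := pe_base peR 1; rewrite rmorph1. Qed.

Lemma pe_opp x y : R (x, y) -> R (- x, - y).
Proof. by move=> Rxy; rewrite -[- x]add0r -[- y]add0r; exact: pe_sub pe_0 Rxy. Qed.

Lemma pe_add x y x' y' : R (x, y) -> R (x', y') -> R (x + x', y + y').
Proof.
by move=> Rx /pe_opp Rx'; rewrite -[x']opprK -[y']opprK; exact: pe_sub Rx Rx'.
Qed.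

Lemma pe_sum n (F G : 'I_n -> E) : (forall i, R (F i, G i)) ->
  R (\sum_(i < n) F i, \sum_(i < n) G i).
Proof.
move=> RFG; elim: n F G RFG => [|n IH] F G RFG; first by rewrite !big_ord0; exact: pe_0.
by rewrite !big_ord_recr /=; apply: pe_add => //; exact: IH.
Qed.

Lemma pe_exp x y n : R (x, y) -> R (x ^+ n, y ^+ n).
Proof.
move=> Rxy; elim: n => [|n IH]; first by rewrite !expr0; exact: pe_1.
by rewrite !exprS; exact: pe_mul.
Qed.

Lemma pe_inj x y y' : R (x, y) -> R (x, y') -> y = y'.
Proof.
move=> Rxy Rxy'; apply/eqP; rewrite -subr_eq0; apply/eqP/(pe_fun peR).
by have := pe_sub peR Rxy Rxy'; rewrite subrr.
Qed.

(* E being algebraic over k, the inverse of x is a polynomial in x over k. *)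
Lemma pe_inv x y : R (x, y) -> x != 0 -> R (x^-1, y^-1).
Proof.
move=> Rxy x0; have [q sq qx] := sepc_separable x.
have q0 : q != 0.
  apply: contraTneq sq => ->.
  by rewrite separable_poly.unlock deriv0 coprime0p -size_poly_eq1 size_poly0.
have [n] := ubnP (size q); elim: n q {sq} q0 qx => // n IHn q q0 qx szq.
case: (eqVneq q`_0 0) => [q00|q00].
  have /factor_theorem[q' Dq] : root q 0 by rewrite /root horner_coef0 q00.
  have q'0 : q' != 0 by apply: contraNneq q0 => q'0; rewrite Dq q'0 mul0r.
  apply: (IHn q') => //.
    move: qx; rewrite Dq subr0 rmorphM rootM /= map_polyX.
    by rewrite [in X in _ || X]/root hornerX (negPf x0) orbF.
  by move: szq; rewrite Dq size_Mmonic ?monicXsubC // size_XsubC addn2.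
have [g Dq] : exists g, q = g * 'X + (q`_0)%:P.
  have : root (q - (q`_0)%:P) 0 by rewrite /root !hornerE horner_coef0 subrr.
  by move/factor_theorem => [g Dg]; exists g; rewrite -['X]subr0 -Dg subrK.
have Rg : R ((map_poly (sepc_in E) g).[x], (map_poly (sepc_in E) g).[y]).
  rewrite !(horner_coef_wide _ (leqnn _)); apply: pe_sum => i.
  by rewrite !coef_map; apply: pe_mul => //; [exact: pe_base|exact: pe_exp].
(* Since [q] vanishes at [x], g(x) x is minus the constant coefficient of [q]. *)
pose c := sepc_in E (- (q`_0)^-1).
have Rh : R (c * (map_poly (sepc_in E) g).[x], c * (map_poly (sepc_in E) g).[y]).
  exact: pe_mul (pe_base peR _) Rg.
have hx : c * (map_poly (sepc_in E) g).[x] * x = 1.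
  move: qx; rewrite /root [in map_poly _ _]Dq rmorphD rmorphM /=.
  rewrite map_polyX map_polyC !hornerE /=.
  rewrite addr_eq0 => /eqP Hq.
  by rewrite /c -mulrA Hq rmorphN fmorphV mulrNN mulVf // fmorph_eq0.
have Ry := pe_mul peR Rh Rxy; rewrite hx in Ry.
have hy := pe_inj Ry pe_1.
have y0 : y != 0 by apply: contra_eq_neq hy => ->; rewrite mulr0 eq_sym oner_eq0.
by rewrite -[x^-1]mul1r -hx mulfK // -[y^-1]mul1r -hy mulfK.
Qed.

Lemma pe_eq0 x y : R (x, y) -> (x == 0) = (y == 0).
Proof.
move=> Rxy; apply/eqP/eqP => [x0|y0]; first by apply: pe_fun peR _ _; rewrite -x0.
apply/eqP/negP => /negP x0; have := pe_mul peR Rxy (pe_inv Rxy x0).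
rewrite y0 mul0r divff // => R10; have := pe_inj R10 pe_1.
by move/esym/eqP; rewrite oner_eq0.
Qed.

Lemma rel_poly_size f g : rel_poly R f g -> size f = size g.
Proof.
move=> Rfg; apply/eqP; rewrite eqn_leq; apply/andP; split; apply/leq_sizeP => j gj.
  by apply/eqP; rewrite (pe_eq0 (Rfg j)); rewrite nth_default.
by apply/eqP; rewrite -(pe_eq0 (Rfg j)); rewrite nth_default.
Qed.

Lemma rel_polyB f g f' g' :
  rel_poly R f g -> rel_poly R f' g' -> rel_poly R (f - f') (g - g').
Proof. by move=> Rf Rf' i; rewrite !coefB; exact: pe_sub. Qed.

Lemma rel_polyD f g f' g' :
  rel_poly R f g -> rel_poly R f' g' -> rel_poly R (f + f') (g + g').
Proof. by move=> Rf Rf' i; rewrite !coefD; exact: pe_add. Qed.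

Lemma rel_polyM f g f' g' :
  rel_poly R f g -> rel_poly R f' g' -> rel_poly R (f * f') (g * g').
Proof. by move=> Rf Rf' i; rewrite !coefM; apply: pe_sum => j; exact: pe_mul. Qed.

Lemma rel_polyC x y : R (x, y) -> rel_poly R x%:P y%:P.
Proof. by move=> Rxy i; rewrite !coefC; case: ifP => _ //; exact: pe_0. Qed.

Lemma rel_polyX n : rel_poly R 'X^n 'X^n.
Proof. by move=> i; rewrite !coefXn; case: eqP => _; [exact: pe_1|exact: pe_0]. Qed.

Lemma rel_poly0 : rel_poly R 0 0.
Proof. by move=> i; rewrite !coef0; exact: pe_0. Qed.

(** Euclidean division run on both members of the pair at once, so that quotients and remainders
    stay related. *)
Lemma rel_poly_div f g f' g' : rel_poly R f g -> rel_poly R f' g' -> f \is monic ->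
  exists q q' r r', [/\ rel_poly R q q', rel_poly R r r', (size r < size f)%N,
    f' = q * f + r & g' = q' * g + r'].
Proof.
move=> Rf Rf' mf; have f0 := monic_neq0 mf.
have szf : (0 < size f)%N by rewrite size_poly_gt0.
have [n] := ubnP (size f'); elim: n f' g' Rf' => // n IHn f' g' Rf' szf'.
have [lt|le] := ltnP (size f') (size f).
  exists 0, 0, f', g'; split=> //; rewrite ?mul0r ?add0r //; exact: rel_poly0.
have szE := rel_poly_size Rf'.
pose d := (size f' - size f)%N.
pose h := (lead_coef f')%:P * 'X^d; pose h' := (lead_coef g')%:P * 'X^d.
have Rh : rel_poly R h h'.
  apply: rel_polyM; last exact: rel_polyX.
  by apply: rel_polyC; rewrite !lead_coefE -szE; exact: Rf'.
have Rs : rel_poly R (f' - h * f) (g' - h' * g).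
  by apply: rel_polyB => //; exact: rel_polyM.
have f'0 : f' != 0 by rewrite -size_poly_gt0 (leq_trans szf).
have szs : (size (f' - h * f)%R < size f')%N.
  have szh : size (h * f) = size f'.
    rewrite size_Mmonic //; last first.
      by rewrite mulf_neq0 ?polyC_eq0 ?lead_coef_eq0 // -size_poly_gt0 size_polyXn.
    rewrite size_Cmul ?lead_coef_eq0 // size_polyXn /d.
    by rewrite addSn /= subnK.
  have lh : lead_coef (h * f) = lead_coef f'.
    by rewrite lead_coefM (monicP mf) mulr1 lead_coefM lead_coefC lead_coefXn mulr1.
  have : (size (f' - h * f)%R <= size f')%N.
    by rewrite (leq_trans (size_polyD _ _)) // size_polyN szh maxnn.
  rewrite leq_eqVlt => /orP[/eqP eqs|//].
  have : lead_coef (f' - h * f) = 0.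
    rewrite lead_coefE eqs coefB -lead_coefE -[in (h * f)`_ _]szh -lead_coefE.
    by rewrite lh subrr.
  move/eqP; rewrite lead_coef_eq0 => /eqP s0; move: eqs; rewrite s0 size_poly0.
  by move/esym/eqP; rewrite size_poly_eq0 (negPf f'0).
have [|q [q' [r [r' [Rq Rr szr Ef Eg]]]]] := IHn _ _ Rs.
  by rewrite -ltnS (leq_trans _ szf').
exists (h + q), (h' + q'), r, r'; split=> //; first exact: rel_polyD.
  by rewrite mulrDl -addrA -Ef addrC subrK.
by rewrite mulrDl -addrA -Eg addrC subrK.
Qed.

(** The extended graph consists of the pairs (h(x), h'(y)) with [h] and [h'] related. It is a
    function: if h(x) = 0, minimality makes [f] divide [h], hence [g] divides [h'], which then
    vanishes at [y]. *)
Lemma pe_extend f g x y : rel_poly R f g -> f \is monic -> root f x ->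
    (forall h h', rel_poly R h h' -> root h x -> (size h < size f)%N -> h = 0) ->
    root g y ->
  exists2 R', partial_embedding R' & (R `<=` R')%classic /\ R' (x, y).
Proof.
move=> Rf mf fx fmin gy.
exists (fun u => exists h h', rel_poly R h h' /\ u = (h.[x], h'.[y])).
  split=> [a|x1 y1 x2 y2|x1 y1 x2 y2|z].
  - exists (sepc_in E a)%:P, (sepc_in E a)%:P; rewrite !hornerC; split=> //.
    by apply: rel_polyC; exact: pe_base.
  - move=> [h [h' [Rh [-> ->]]]] [h1 [h1' [Rh1 [-> ->]]]].
    by exists (h - h1), (h' - h1'); rewrite !hornerE; split=> //; exact: rel_polyB.
  - move=> [h [h' [Rh [-> ->]]]] [h1 [h1' [Rh1 [-> ->]]]].
    by exists (h * h1), (h' * h1'); rewrite !hornerE; split=> //; exact: rel_polyM.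
  move=> [h [h' [Rh [hx ->]]]].
  have [q [q' [r [r' [Rq Rr szr Ef Eg]]]]] := rel_poly_div Rf Rh mf.
  have r0 : r = 0.
    apply: fmin Rr _ szr; move: hx.
    by rewrite Ef !hornerE (eqP fx) mulr0 add0r => /esym/eqP.
  have r'0 : r' = 0.
    by apply/eqP; rewrite -size_poly_eq0 -(rel_poly_size Rr) r0 size_poly0.
  by rewrite Eg r'0 addr0 !hornerE (eqP gy) mulr0.
split=> [[a b] Rab|]; last first.
  by exists 'X, 'X; rewrite !hornerX; split=> //; rewrite -['X]expr1; exact: rel_polyX.
by exists a%:P, b%:P; rewrite !hornerC; split=> //; exact: rel_polyC.
Qed.

(** [f] is the minimal polynomial of [x] over the domain of [R], and [g] its image. A separable
    polynomial over k that kills [x] is related to itself, so [g] divides it and is separable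
    too. *)
Lemma pe_minimal_poly x : exists f g, [/\ rel_poly R f g, f \is monic, root f x,
  separable_poly g & forall h h', rel_poly R h h' -> root h x ->
    (size h < size f)%N -> h = 0].
Proof.
have [q sq qx] := sepc_separable x.
have q0 : q != 0.
  apply: contraTneq sq => ->.
  by rewrite separable_poly.unlock deriv0 coprime0p -size_poly_eq1 size_poly0.
pose Q := map_poly (sepc_in E) q.
have RQ : rel_poly R Q Q by move=> i; rewrite coef_map; exact: pe_base.
have Q0 : Q != 0 by rewrite map_poly_eq0.
pose P n := `[< exists f g, [/\ rel_poly R f g, f != 0, root f x & size f = n] >].
have exP : exists n, P n by exists (size Q); apply/asboolP; exists Q, Q.
case: (ex_minnP exP) => n /asboolP[f0 [g0 [Rfg0 f00 f0x szf0]]] nmin.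
have g00 : g0 != 0 by rewrite -size_poly_gt0 -(rel_poly_size Rfg0) size_poly_gt0.
pose f := (lead_coef f0)^-1%:P * f0; pose g := (lead_coef g0)^-1%:P * g0.
have Rfg : rel_poly R f g.
  apply: rel_polyM => //; apply: rel_polyC; apply: pe_inv; rewrite ?lead_coef_eq0 //.
  by rewrite !lead_coefE -(rel_poly_size Rfg0).
have szf : size f = n by rewrite size_Cmul // invr_eq0 lead_coef_eq0.
have mf : f \is monic.
  by rewrite monicE lead_coefM lead_coefC mulVf // lead_coef_eq0.
have fx : root f x by rewrite rootM f0x orbT.
have fmin h h' : rel_poly R h h' -> root h x -> (size h < size f)%N -> h = 0.
  move=> Rh hx; apply: contraTeq => h0; rewrite -leqNgt szf; apply: nmin.
  by apply/asboolP; exists h, h'.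
exists f, g; split=> //.
have [a [a' [r [r' [Ra Rr szr Ef Eg]]]]] := rel_poly_div Rfg RQ mf.
have r0 : r = 0.
  apply: fmin Rr _ szr; move: qx; rewrite -/Q Ef /root hornerD hornerM (eqP fx).
  by rewrite mulr0 add0r.
have r'0 : r' = 0.
  by apply/eqP; rewrite -size_poly_eq0 -(rel_poly_size Rr) r0 size_poly0.
have sQ : separable_poly Q by rewrite separable_map.
by apply: dvdp_separable sQ; rewrite Eg r'0 addr0 dvdp_mull.
Qed.

End PartialEmbedding.

(** Zorn's lemma: a maximal extension is total, as minimal polynomials have roots in E to map to,
    and onto, as it injects the finite set of roots of each polynomial over k into itself. *)
Lemma pe_total (R : set (E * E)) : partial_embedding R ->
  exists s : Gal E, forall x y, R (x, y) -> s x = y.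
Proof.
move=> peR.
pose P (A : set (E * E)) := A = set0 \/ partial_embedding A /\ (R `<=` A)%classic.
have [|A [PA Amax]] := @Zorn_bigcup _ P.
  move=> F FP Ftot.
  have [[A FA A0]|noF] := pselect (exists2 A, F A & A <> set0); last first.
    left; rewrite -subset0 => u [A FA Au]; case: noF; exists A => // A0.
    by rewrite A0 in Au.
  right; have [//|[peA RA]] := FP _ FA.
  have dir B C : F B -> F C -> B <> set0 -> exists D, [/\ F D, partial_embedding D,
      (B `<=` D)%classic & (C `<=` D)%classic].
    move=> FB FC B0; have [//|[peB _]] := FP _ FB.
    have [BC|CB] := Ftot _ _ FB FC; last by exists B; split.
    exists C; split=> //; have [C0|[]//] := FP _ FC.
    by case: B0; rewrite -subset0 -C0.
  have ne (B : set (E * E)) u : B u -> B <> set0 by move=> Bu B0; rewrite B0 in Bu.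
  split; last by move=> u /RA Au; exists A.
  split=> [a|x y x' y' [B FB Bu] [C FC Cu]|x y x' y' [B FB Bu] [C FC Cu]|y [B FB Bu]].
  - by exists A => //; exact: pe_base.
  - have [D [FD peD BD CD]] := dir _ _ FB FC (ne _ _ Bu).
    by exists D => //; apply: (pe_sub peD); [exact: BD|exact: CD].
  - have [D [FD peD BD CD]] := dir _ _ FB FC (ne _ _ Bu).
    by exists D => //; apply: (pe_mul peD); [exact: BD|exact: CD].
  have [B0|[peB _]] := FP _ FB; last exact: (pe_fun peB).
  by rewrite B0 in Bu.
have [peA RA] : partial_embedding A /\ (R `<=` A)%classic.
  have [A0|//] := PA; exfalso; apply: (Amax R); last by right; split.
  rewrite A0 properEneq; split=> //; apply/eqP => R0.
  by have := pe_base peR 0; rewrite -R0.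
have /choice[g gA] : forall x, exists y, A (x, y).
  move=> x; have [f [h [Afh mf fx sh fmin]]] := pe_minimal_poly peA x.
  have sz1 : (1 < size h)%N.
    rewrite -(rel_poly_size peA Afh) ltnNge; apply: contraTN fx => szf.
    move: mf; rewrite [f]size1_polyC // monicE lead_coefC => /eqP ->.
    by rewrite root1.
  have [y hy] := sepc_closed sh sz1.
  have [A' peA' [AA' A'xy]] := pe_extend peA Afh mf fx fmin hy.
  exists y; apply: contrapT => nA; apply: (Amax A').
    by split=> // A'A; apply: nA; exact: A'A.
  by right; split=> // u /RA/AA'.
have gD : {morph g : x y / x + y}.
  by move=> x y; apply: (pe_inj peA (gA _)); exact: pe_add.
have gM : {morph g : x y / x * y}.
  by move=> x y; apply: (pe_inj peA (gA _)); exact: pe_mul.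
have gF a : g (sepc_in E a) = sepc_in E a.
  by apply: (pe_inj peA (gA _)); exact: pe_base.
have g0 x : g x = 0 -> x = 0.
  by move=> gx; apply/eqP; rewrite (pe_eq0 peA (gA x)) gx.
have gB x y : g (x - y) = g x - g y.
  by apply: (pe_inj peA (gA _)); exact: pe_sub.
have gI : injective g.
  by move=> x y gxy; apply/eqP; rewrite -subr_eq0; apply/eqP/g0; rewrite gB gxy subrr.
have groot (q : {poly k}) x : root (map_poly (sepc_in E) q) x ->
    root (map_poly (sepc_in E) q) (g x).
  move=> qx; rewrite /root; rewrite -(pe_eq0 peA (x := (map_poly (sepc_in E) q).[x])) //.
  rewrite !(horner_coef_wide _ (leqnn _)); apply: pe_sum => // i.
  by rewrite !coef_map; apply: pe_mul => //; [exact: pe_base|exact: pe_exp].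
have /choice[h hP] : forall z, exists x, g x = z.
  move=> z; have [q sq qz] := sepc_separable z.
  have [|rs rsP] := @finite_roots _ E (map_poly (sepc_in E) q).
    rewrite map_poly_eq0; apply: contraTneq sq => ->.
    by rewrite separable_poly.unlock deriv0 coprime0p -size_poly_eq1 size_poly0.
  pose rq := undup [seq x <- rs | root (map_poly (sepc_in E) q) x].
  have rqP x : (x \in rq) = root (map_poly (sepc_in E) q) x.
    rewrite mem_undup mem_filter; apply/andP/idP => [[]//|qx].
    by split=> //; exact: rsP.
  have sub : {subset map g rq <= rq}.
    by move=> _ /mapP[x + ->]; rewrite !rqP; exact: groot.
  have uq : uniq (map g rq) by rewrite (map_inj_uniq gI) undup_uniq.
  have [|_ E2] := uniq_min_size uq sub; first by rewrite size_map.
  have : z \in map g rq by rewrite E2 rqP.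
  by move=> /mapP[x _ ->]; exists x.
have gb : bijective g by exists h => x //; apply: gI; rewrite hP.
exists (MkGal gD gM gb gF) => x y Rxy /=.
by apply: (pe_inj peA (gA _)); exact: RA.
Qed.

(** If the minimal polynomial of [x] over k had degree above 1, a root [y] of its cofactor at [x]
    would be the image of [x] under some automorphism. Then y = x is a double root, against
    separability. *)
Theorem gal_fixed_base x : (forall s, s x = x) -> exists a, x = sepc_in E a.
Proof.
move=> sx.
pose R0 : set (E * E) := fun u => exists a, u = (sepc_in E a, sepc_in E a).
have pe0 : partial_embedding R0.
  split=> [a|? ? ? ? [a [-> ->]] [b [-> ->]]|? ? ? ? [a [-> ->]] [b [-> ->]]|y [a [-> ->]]//].
  - by exists a.
  - by exists (a - b); rewrite rmorphB.
  - by exists (a * b); rewrite rmorphM.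
have [f [g [Rfg mf fx sg fmin]]] := pe_minimal_poly pe0 x.
have gf : g = f.
  by apply/polyP => i; have [a [-> ->]] := Rfg i.
subst g; have /factor_theorem[f' Df] := fx.
have [sz|sz] := leqP (size f') 1.
  have : f = 'X - x%:P.
    move: mf; rewrite Df [f']size1_polyC // monicE lead_coefM lead_coefC lead_coefXsubC.
    by rewrite mulr1 => /eqP ->; rewrite mul1r.
  move=> fE; have [a [_]] := Rfg 0; rewrite fE coefB coefX coefC /= sub0r => Ha.
  by exists (- a); rewrite rmorphN -Ha opprK.
have sf' : separable_poly f' by apply: dvdp_separable sg; rewrite Df dvdp_mulr.
have [y f'y] := sepc_closed sf' sz.
have fy : root f y by rewrite Df rootM f'y.
have [R' peR' [RR' R'xy]] := pe_extend pe0 Rfg mf fx fmin fy.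
have [s sP] := pe_total peR'.
have yx : y = x by rewrite -(sP _ _ R'xy) sx.
move: sg; rewrite Df separable_root => /andP[_].
by rewrite -yx f'y.
Qed.

End GaloisAction.

(** * Averaging, twisted cohomology and descent *)

Section Averaging.
Variables (k : fieldType) (E : sepClosure k).
Implicit Types (s t q g : Gal E) (r : seq E) (Q : seq (Gal E)).

(** Local constancy with an explicit uniform modulus [r]; it stands for continuity at a finite
    level. *)
Definition loc_const (T : Type) r (f : Gal E -> T) : Prop :=
  forall s t, {in r, s =1 t} -> f s = f t.

Lemma loc_constW (T : Type) r r' (f : Gal E -> T) :
  {subset r <= r'} -> loc_const r f -> loc_const r' f.
Proof. by move=> rr' fr s t st; apply: fr => x /rr'; exact: st. Qed.

Lemma orbits_finite r : exists rs : seq E, forall s, {in r, forall x, s x \in rs}.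
Proof.
elim: r => [|x r [rs rsP]]; first by exists [::].
have [rx rxP] := gal_orbit_finite x; exists (rx ++ rs) => s y.
rewrite inE mem_cat => /predU1P[->|/(rsP s) ->]; last by rewrite orbT.
by have [-> _] := rxP s.
Qed.

(** Agreement on [r] is the left coset relation of the stabilizer of [r], a subgroup that need not
    be normal; [Q] represents the embeddings of k(r) into E. *)
Definition transversal r Q : Prop := [/\ uniq Q,
  {in Q &, forall q q', {in r, q =1 q'} -> q = q'} &
  forall s, exists2 q, q \in Q & {in r, s =1 q}].

(** The restriction of [s] to [r] is coded by the positions of its values in a finite list that
    contains all orbits; one automorphism is chosen for each code that occurs. *)
Lemma transversal_exists r : exists Q, transversal r Q.
Proof.
have [rs rsP] := orbits_finite r.
pose H := {ffun 'I_(size r) -> 'I_(size rs).+1}.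
pose code s : H := [ffun i : 'I_(size r) => inord (index (s r`_i) rs)].
have codeP s t : code s = code t -> {in r, s =1 t}.
  move=> st x xr; have ir : (index x r < size r)%N by rewrite index_mem.
  have := congr1 (fun h : H => val (h (Ordinal ir))) st; rewrite !ffunE /= !nth_index //.
  rewrite !inordK ?ltnS ?index_size // => Eix.
  by rewrite -[s x](nth_index 0 (rsP s x xr)) Eix nth_index // rsP.
have codeE s t : {in r, s =1 t} -> code s = code t.
  by move=> st; apply/ffunP => i; rewrite !ffunE st // mem_nth.
have /choice[l lP] : forall h : H, exists s, (exists t, code t = h) -> code s = h.
  move=> h; have [[t th]|no] := pselect (exists t, code t = h); first by exists t.
  by exists 1%g.
pose D := [seq h <- enum {: H} | `[< exists t, code t = h >]].
have DP h : h \in D -> code (l h) = h.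
  by rewrite mem_filter => /andP[/asboolP/lP].
exists (map l D); split.
- rewrite map_inj_in_uniq; first by rewrite filter_uniq // enum_uniq.
  by move=> h h' /DP hE /DP h'E ll; rewrite -hE ll.
- move=> _ _ /mapP[h /DP hD ->] /mapP[h' /DP h'D ->] /codeE.
  by rewrite hD h'D => ->.
move=> s; have sD : code s \in D.
  by rewrite mem_filter mem_enum andbT; apply/asboolP; exists s.
by exists (l (code s)); [exact: map_f|apply: codeP; rewrite DP].
Qed.

(** Left translation by [g] permutes the cosets represented by [Q]. *)
Lemma transversal_sum (V : zmodType) r Q (F : Gal E -> V) g :
  transversal r Q -> loc_const r F ->
  \sum_(q <- Q) F (g * q)%g = \sum_(q <- Q) F q.
Proof.
move=> [uQ sQ cQ] Fr; have /choice[rep repP] : forall s, exists q,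
    q \in Q /\ {in r, s =1 q} by move=> s; have [q] := cQ s; exists q.
rewrite (eq_bigr (fun q => F (rep (g * q)%g))); last first.
  by move=> q _; apply: Fr; have [] := repP (g * q)%g.
rewrite -(big_map (fun q => rep (g * q)%g) xpredT F); apply: perm_big.
have uM : uniq [seq rep (g * q)%g | q <- Q].
  rewrite map_inj_in_uniq // => q q' qQ q'Q qq'; apply: sQ => // x xr.
  have [_ H] := repP (g * q)%g; have [_ H'] := repP (g * q')%g.
  have /(can_inj (gal_funK g)) -> // : g (q x) = g (q' x).
  by rewrite -!gal_mulE H // qq' H'.
have sub : {subset [seq rep (g * q)%g | q <- Q] <= Q}.
  by move=> _ /mapP[q _ ->]; have [] := repP (g * q)%g.
have [|_ EQ] := uniq_min_size uM sub; first by rewrite size_map.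
exact: uniq_perm.
Qed.

(* Dedekind's independence of the characters q in Q, tested on those elements
   of E on which s acts through the restriction of s to r. *)
Lemma transversal_independent r Q (f : Gal E -> E) : transversal r Q ->
  (forall l, loc_const r (fun s => s l) -> \sum_(q <- Q) f q * q l = 0) ->
  {in Q, forall q, f q = 0}.
Proof.
case=> uQ sQ _; elim: Q f uQ sQ => // q0 Q IH f /= /andP[q0Q uQ] sQ f0.
have fQ : {in Q, forall q, f q = 0}.
  move=> q qQ.
  have [x xr qx] : exists2 x, x \in r & q x != q0 x.
    have [//|no] := pselect (exists2 x, x \in r & q x != q0 x).
    case/negP: q0Q; rewrite -(sQ q q0) ?inE ?eqxx ?qQ ?orbT // => x xr.
    by apply/eqP/negP => /negP qx; apply: no; exists x.
  have lx : loc_const r (fun s => s x) by move=> s t ->.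
  suff /eqP : f q * (q x - q0 x) = 0.
    by rewrite mulf_eq0 subr_eq0 (negPf qx) orbF => /eqP.
  (* The relation at [x * l] minus [q0 x] times the relation at [l] has no [q0] term. *)
  apply: (IH (fun q => f q * (q x - q0 x)) uQ) => // [a b aQ bQ|l lr].
    by apply: sQ; rewrite inE ?aQ ?bQ orbT.
  have lxl : loc_const r (fun s => s (x * l)).
    by move=> s t st; rewrite !rmorphM /= (lx s t) ?(lr s t).
  have := f0 _ lxl; rewrite big_cons => H1.
  have := f0 _ lr; rewrite big_cons => H2.
  transitivity ((f q0 * q0 (x * l) + \sum_(j <- Q) f j * j (x * l)) -
     q0 x * (f q0 * q0 l + \sum_(j <- Q) f j * j l)); last by rewrite H1 H2 mulr0 subrr.
  rewrite rmorphM /= mulrDr opprD addrACA mulrCA subrr add0r mulr_sumr -sumrB.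
  apply: eq_bigr => j _; rewrite rmorphM /= mulrBr mulrBl mulrA.
  by congr (_ - _); rewrite [RHS]mulrCA mulrA.
move=> q; rewrite inE => /predU1P[->|/fQ//].
have := f0 1; rewrite big_cons rmorph1 mulr1 big1_seq ?addr0; last first.
  by move=> j /andP[_ /fQ ->]; rewrite mul0r.
by apply=> s t _; rewrite !rmorph1.
Qed.

(** Independence of characters gives an element of nonzero trace; the trace is invariant, so
    dividing by it normalizes. The weights [q x] replace division by the number of cosets, which p
    may divide. *)
Lemma transversal_trace1 r Q : transversal r Q ->
  exists2 x, loc_const r (fun s => s x) & \sum_(q <- Q) q x = 1.
Proof.
move=> tQ; have [_ _ cQ] := tQ; have [q qQ _] := cQ 1%g.
have [[l lr l0]|no] := pselect (exists2 l, loc_const r (fun s => s l) &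
    \sum_(q <- Q) q l != 0); last first.
  have /eqP : (1 : E) = 0; last by rewrite oner_eq0.
  apply: (transversal_independent (f := fun=> 1) tQ _ qQ) => l lr.
  under eq_bigr do rewrite mul1r.
  by apply/eqP/negP => /negP l0; apply: no; exists l.
set a := \sum_(q <- Q) q l in l0.
have sa s : s a = a.
  by rewrite /a rmorph_sum /= -[RHS](transversal_sum s tQ).
exists (a^-1 * l).
  by move=> s t st; rewrite !rmorphM !fmorphV /= !sa (lr s t).
under eq_bigr do rewrite rmorphM fmorphV /= sa.
by rewrite -mulr_sumr mulVf.
Qed.

(** * Vanishing of twisted cohomology and Galois descent *)

Section Twisted.
Variables (n : nat) (A : Gal E -> 'M[E]_n).

(** The semilinear action on row vectors. The matrix multiplies on the right, whence the reversed
    order in [AM] below. *)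
Definition tact s m (x : 'M[E]_(m, n)) : 'M_(m, n) := map_mx s x *m A s.

Fact tact_is_additive s m : zmod_morphism (@tact s m).
Proof. by move=> x y; rewrite /tact map_mxB mulmxBl. Qed.

HB.instance Definition _ s m :=
  GRing.isZmodMorphism.Build 'M[E]_(m, n) 'M[E]_(m, n) (@tact s m) (@tact_is_additive s m).

Lemma tactD s m (x y : 'M_(m, n)) : tact s (x + y) = tact s x + tact s y.
Proof. exact: raddfD. Qed.

Lemma tactB s m (x y : 'M_(m, n)) : tact s (x - y) = tact s x - tact s y.
Proof. exact: raddfB. Qed.

Lemma tact_base s m (c : 'M[k]_(m, n)) (P : 'M_n) : tact s P = P ->
  tact s (map_mx (sepc_in E) c *m P) = map_mx (sepc_in E) c *m P.
Proof.
rewrite /tact map_mxM -mulmxA => ->; congr (_ *m _).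
by apply/matrixP => a b; rewrite !mxE; exact: gal_fix.
Qed.

Lemma tactZ s m a (x : 'M_(m, n)) : tact s (a *: x) = s a *: tact s x.
Proof. by rewrite /tact map_mxZ scalemxAl. Qed.

(** The bounding vector is the average of [z] with weights [q x] of sum 1; the cocycle identity
    turns its translate by [s] into the same average minus [z s]. *)
Lemma twisted_H1 r (z : Gal E -> 'rV[E]_n) : loc_const r z ->
  (forall s t, z (s * t)%g = z s + tact s (z t)) ->
  exists a, forall s, z s = a - tact s a.
Proof.
move=> zr zM; have [Q tQ] := transversal_exists r.
have [x xr x1] := transversal_trace1 tQ.
pose F q := q x *: z q.
have Fr : loc_const r F by move=> s t st; rewrite /F (xr s t) // (zr s t).
exists (\sum_(q <- Q) F q) => s; rewrite raddf_sum /=.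
rewrite -(transversal_sum s tQ Fr) -sumrB.
transitivity (\sum_(q <- Q) (s * q)%g x *: z s).
  by rewrite -scaler_suml (transversal_sum s tQ xr) x1 scale1r.
by apply: eq_bigr => q _; rewrite /F tactZ zM scalerDr addrK.
Qed.

(** The same weighted average over the second variable of [c], with the cocycle identity at (s, t,
    q). The result lives at a finer level than [r], because the weight [(g * q) x] depends on the
    value of [g] at [q x]. *)
Lemma twisted_H2 r (c : Gal E -> Gal E -> 'rV[E]_n) :
  (forall s, loc_const r (c s)) -> (forall t, loc_const r (c^~ t)) ->
  (forall g h q, c g h + c (g * h)%g q = tact g (c h q) + c g (h * q)%g) ->
  exists2 b, (exists r', loc_const r' b) &
    forall s t, c s t = b s + tact s (b t) - b (s * t)%g.
Proof.
move=> cr1 cr2 cM; have [Q tQ] := transversal_exists r.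
have [x xr x1] := transversal_trace1 tQ.
pose F g q := (g * q)%g x *: c g q.
have Fr g : loc_const r (F g).
  by move=> s t st; rewrite /F !gal_mulE (xr s t) // (cr1 g s t).
exists (fun g => \sum_(q <- Q) F g q).
  exists (r ++ [seq q x | q <- Q]) => s t st; apply: eq_big_seq => q qQ.
  rewrite /F !gal_mulE (st (q x)); last first.
    by rewrite mem_cat orbC (map_f (fun q : Gal E => q x)).
  by congr (_ *: _); apply: cr2 => y yr; apply: st; rewrite mem_cat yr.
move=> s t; rewrite raddf_sum /= -(transversal_sum t tQ (Fr s)) -big_split -sumrB /=.
transitivity (\sum_(q <- Q) (s * t * q)%g x *: c s t).
  by rewrite -scaler_suml (transversal_sum _ tQ xr) x1 scale1r.
apply: eq_bigr => q _; rewrite /F tactZ -gal_mulE !mulgA -scalerDr -scalerBr.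
by rewrite [c s _ + _]addrC -cM addrK.
Qed.

Hypothesis A_fix : forall s t, map_mx s (A t) = A t.
Hypothesis AM : forall s t, A (s * t)%g = A t *m A s.
Hypothesis A_unit : forall s, A s \in unitmx.

Lemma tactM s t m (x : 'M_(m, n)) : tact (s * t)%g x = tact s (tact t x).
Proof.
rewrite /tact map_mxM A_fix AM mulmxA; congr (_ *m _ *m _).
by apply/matrixP => i j; rewrite !mxE.
Qed.

(** The traces [X l] are invariant, and no nonzero linear form kills all of them, by independence of
    characters and invertibility of [A q]. Applied to a form [f] that vanishes on the rows already
    found, this gives a new independent row. *)
Lemma tact_invariant_basis r : loc_const r A ->
  exists2 P : 'M_n, P \in unitmx & forall s, tact s P = P.
Proof.
move=> Ar; have [Q tQ] := transversal_exists r; have [_ _ cQ] := tQ.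
pose X l := \sum_(q <- Q) q l *: A q.
have XP l s : loc_const r (fun s => s l) -> tact s (X l) = X l.
  move=> lr; have Fr : loc_const r (fun q => q l *: A q).
    by move=> a b ab; rewrite (lr a b) // (Ar a b).
  rewrite /X -[in RHS](transversal_sum s tQ Fr) raddf_sum; apply: eq_bigr => q _ /=.
  by rewrite tactZ /tact A_fix AM.
suff [P PP rP] : exists2 P : 'M_n, (forall s, tact s P = P) & \rank P = n.
  by exists P; rewrite // -row_full_unit /row_full rP.
suff H d : (d <= n)%N -> exists2 P : 'M_(d, n), (forall s, tact s P = P) & \rank P = d.
  exact: H.
elim: d => [|d IH] dn.
  by exists 0; [move=> s; rewrite raddf0|rewrite mxrank0].
have [B BP rB] := IH (ltnW dn).
have [f f0 Bf] : exists2 f : 'cV[E]_n, f != 0 & B *m f = 0.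
  have : cokermx B != 0 by rewrite -mxrank_eq0 mxrank_coker rB -lt0n subn_gt0.
  case/matrix0Pn => i [j cij]; exists (col j (cokermx B)).
    by apply/matrix0Pn; exists i, 0; rewrite mxE.
  by rewrite colE mulmxA mulmx_coker mul0mx.
have [l lr Xf] : exists2 l, loc_const r (fun s => s l) & X l *m f != 0.
  have [//|no] := pselect (exists2 l, loc_const r (fun s => s l) & X l *m f != 0).
  have [q qQ _] := cQ 1%g.
  have Af : A q *m f = 0.
    apply/matrixP => i j.
    rewrite [RHS]mxE; apply: (transversal_independent (f := fun q => (A q *m f) i j) tQ _ qQ).
    move=> l lr; have : X l *m f = 0.
      by apply/eqP/negP => /negP Xf; apply: no; exists l.
    move/matrixP/(_ i j); rewrite /X mulmx_suml summxE [RHS]mxE => XE; rewrite -[RHS]XE.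
    by apply: eq_bigr => a _; rewrite -scalemxAl [RHS]mxE mulrC.
  by case/eqP: f0; rewrite -(mulKmx (A_unit q) f) Af mulmx0.
have [i xf] : exists i, row i (X l) *m f != 0.
  case/matrix0Pn: Xf => i [j ij]; exists i; apply/matrix0Pn; exists 0, j.
  by rewrite -row_mul mxE.
have xP s : tact s (row i (X l)) = row i (X l).
  by rewrite /tact map_row -row_mul -[RHS](congr1 (row i) (XP l s lr)).
have xBP s : tact s (col_mx (row i (X l)) B) = col_mx (row i (X l)) B.
  by rewrite /tact map_col_mx mul_col_mx; congr col_mx; [exact: xP|exact: BP].
exists (col_mx (row i (X l)) B); first exact: xBP.
apply/eqP; rewrite eqn_leq rank_leq_row /= ltnNge.
have sB : (B <= col_mx (row i (X l)) B)%MS by rewrite -addsmxE addsmxSr.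
apply/negP => le; have : (col_mx (row i (X l)) B <= B)%MS.
  by rewrite -(geq_leqif (mxrank_leqif_sup sB)) rB.
rewrite col_mx_sub => /andP[/submxP[D DB] _].
by case/eqP: xf; rewrite DB -mulmxA Bf mulmx0.
Qed.

Lemma gal_fixed_mx m m' (x : 'M[E]_(m, m')) : (forall s, map_mx s x = x) ->
  exists c, x = map_mx (sepc_in E) c.
Proof.
move=> sx; have /choice[c cP] : forall ij : 'I_m * 'I_m', exists a, x ij.1 ij.2 = sepc_in E a.
  move=> [i j]; apply: gal_fixed_base => s.
  by have /matrixP/(_ i j) := sx s; rewrite mxE.
by exists (\matrix_(i, j) c (i, j)); apply/matrixP => i j; rewrite !mxE -cP.
Qed.

(** The coordinates of an invariant vector in an invariant basis are Galois-fixed, hence lie in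
    k. *)
Lemma tact_fixed P m (x : 'M_(m, n)) : P \in unitmx -> (forall s, tact s P = P) ->
  (forall s, tact s x = x) -> exists c, x = map_mx (sepc_in E) c *m P.
Proof.
move=> uP PP xP; have [|c cE] := @gal_fixed_mx _ _ (x *m invmx P).
  move=> s; apply: (can_inj (mulmxK uP)); rewrite mulmxKV // -{2}(PP s).
  by rewrite mulmxA -map_mxM mulmxKV //; exact: xP.
by exists c; rewrite -cE mulmxKV.
Qed.

End Twisted.
End Averaging.

(** * Frobenius and the Artin-Schreier equation *)

Section PrimeField.
Variables (p : nat) (K : fieldType) (charK : p \in [pchar K]).

Definition Fp_in of p \in [pchar K] := fun x : 'F_p => (nat_of_ord x)%:R : K.

Let Fp_modn m : (m %% (Zp_trunc (pdiv p)).+2)%:R = m%:R :> K.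
Proof. by rewrite Fp_cast ?(pcharf_prime charK) // (GRing.natr_mod_pchar charK). Qed.

Fact Fp_in_nmod_morphism : nmod_morphism (Fp_in charK).
Proof. by split=> // x y; rewrite /Fp_in /= Fp_modn natrD. Qed.

Fact Fp_in_monoid_morphism : monoid_morphism (Fp_in charK).
Proof. by split=> // x y; rewrite /Fp_in /= Fp_modn natrM. Qed.

HB.instance Definition _ :=
  GRing.isNmodMorphism.Build 'F_p K (Fp_in charK) Fp_in_nmod_morphism.
HB.instance Definition _ :=
  GRing.isMonoidMorphism.Build 'F_p K (Fp_in charK) Fp_in_monoid_morphism.

Definition Frob m n (x : 'M[K]_(m, n)) := map_mx (pFrobenius_aut charK) x.

Lemma FrobD m n (x y : 'M_(m, n)) : Frob (x + y) = Frob x + Frob y.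
Proof. exact: map_mxD. Qed.

Lemma FrobB m n (x y : 'M_(m, n)) : Frob (x - y) = Frob x - Frob y.
Proof. exact: map_mxB. Qed.

Lemma FrobM l m n (x : 'M_(l, m)) (y : 'M_(m, n)) : Frob (x *m y) = Frob x *m Frob y.
Proof. exact: map_mxM. Qed.

Lemma Frob_Fp m n (x : 'M_(m, n)) :
  Frob (map_mx (Fp_in charK) x) = map_mx (Fp_in charK) x.
Proof. by apply/matrixP => i j; rewrite !mxE pFrobenius_aut_nat. Qed.

(** X^p - X has at most p roots, and 'F_p already supplies p of them. *)
Lemma Frob_fixed m n (x : 'M_(m, n)) : Frob x = x ->
  exists y, x = map_mx (Fp_in charK) y.
Proof.
move=> Fx; have pp := pcharf_prime charK.
have /choice[y yP] : forall ij : 'I_m * 'I_n, exists a, x ij.1 ij.2 = Fp_in charK a.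
  move=> [i j] /=; apply: contrapT => no.
  pose rs := x i j :: [seq Fp_in charK a | a <- enum 'F_p].
  pose f : {poly K} := 'X^p - 'X.
  have szf : size f = p.+1.
    by rewrite size_polyDl ?size_polyXn // size_polyN size_polyX ltnS prime_gt1.
  have f0 : f != 0 by rewrite -size_poly_eq0 szf.
  suff : (size rs < size f)%N.
    by rewrite szf /= size_map -cardE card_Fp // ltnn.
  apply: max_poly_roots => //.
    apply/allP => z; rewrite inE => /predU1P[->|/mapP[a _ ->]]; rewrite /root !hornerE.
      by have /matrixP/(_ i j) := Fx; rewrite mxE pFrobenius_autE => ->; rewrite subrr.
    by rewrite -(pFrobenius_autE charK) pFrobenius_aut_nat subrr.
  rewrite /= map_inj_uniq ?enum_uniq ?andbT; last exact: fmorph_inj.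
  by apply/mapP => -[a _ xa]; apply: no; exists a.
by exists (\matrix_(i, j) y (i, j)); apply/matrixP => i j; rewrite !mxE -yP.
Qed.

End PrimeField.

Lemma map_mx_Fp p (K L : fieldType) (charK : p \in [pchar K])
    (charL : p \in [pchar L]) (f : {rmorphism K -> L}) m n (x : 'M['F_p]_(m, n)) :
  map_mx f (map_mx (Fp_in charK) x) = map_mx (Fp_in charL) x.
Proof. by apply/matrixP => i j; rewrite !mxE rmorph_nat. Qed.

Lemma map_mx_Frob p (K L : fieldType) (charK : p \in [pchar K])
    (charL : p \in [pchar L]) (f : {rmorphism K -> L}) m n (x : 'M[K]_(m, n)) :
  map_mx f (Frob charK x) = Frob charL (map_mx f x).
Proof. by apply/matrixP => i j; rewrite !mxE !pFrobenius_autE rmorphXn. Qed.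

(** X^p - X - a has derivative -1, so it is separable and has a root in E. *)
Lemma artin_schreier (k : fieldType) (E : sepClosure k) p (charE : p \in [pchar E])
    m n (a : 'M[E]_(m, n)) : exists w, Frob charE w - w = a.
Proof.
have pp := pcharf_prime charE.
have /choice[w wP] : forall ij : 'I_m * 'I_n, exists b : E, b ^+ p - b = a ij.1 ij.2.
  move=> [i j] /=; pose f : {poly E} := 'X^p - 'X - (a i j)%:P.
  have szf : size f = p.+1.
    rewrite /f -addrA size_polyDl size_polyXn // -opprD size_polyN ltnS.
    by rewrite size_XaddC prime_gt1.
  have sf : separable_poly f.
    have df : f^`() = - 1.
      rewrite /f !derivB derivXn derivX derivC subr0 -mulr_natr.
      by rewrite -polyC_natr (pcharf0 charE) mulr0 sub0r.
    rewrite separable_poly.unlock df -scaleN1r coprimepZr ?coprimep1 //.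
    by rewrite oppr_eq0 oner_neq0.
  have [|b] := sepc_closed sf; first by rewrite szf ltnS prime_gt0.
  by rewrite /root !hornerE subr_eq0 => /eqP; exists b.
exists (\matrix_(i, j) w (i, j)); apply/matrixP => i j.
by rewrite !mxE pFrobenius_autE wP.
Qed.


Lemma Frob_tact (k : fieldType) (E : sepClosure k) p (charE : p \in [pchar E]) n
    (A : Gal E -> 'M_n) s l (x : 'M_(l, n)) : Frob charE (A s) = A s ->
  Frob charE (tact A s x) = tact A s (Frob charE x).
Proof. by move=> FA; rewrite /tact FrobM FA (map_mx_Frob charE charE). Qed.

(** * Discrete valuations *)

Section Valuation.
Variables (k : fieldType) (v : dvaluation k).
Implicit Types (x y : k) (m n : int).

Lemma dval1 : v 1 = 0.
Proof.
have := dvalM v (oner_neq0 k) (oner_neq0 k); rewrite mulr1.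
by move/(congr1 (fun z => z - v 1)); rewrite subrr addrK.
Qed.

Lemma dvalV x : x != 0 -> v x^-1 = - v x.
Proof.
move=> x0; apply/eqP; rewrite -addr_eq0; apply/eqP.
by rewrite -dvalM ?invr_eq0 // mulVf // dval1.
Qed.

Lemma dvalX x i : x != 0 -> v (x ^+ i) = v x *+ i.
Proof.
move=> x0; elim: i => [|i IH]; first by rewrite expr0 dval1.
by rewrite exprS dvalM ?expf_neq0 // IH mulrS.
Qed.

Lemma dvalN x : x != 0 -> v (- x) = v x.
Proof.
move=> x0; have N0 : (-1 : k) != 0 by rewrite oppr_eq0 oner_neq0.
have vN : v (-1) = 0.
  have := dvalX 2 N0; rewrite sqrrN expr1n dval1 => /esym/eqP.
  by rewrite mulrn_eq0 => /eqP.
by rewrite -mulN1r dvalM // vN add0r.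
Qed.

Lemma dval_ge_id x : dval_ge v (v x) x. Proof. by right. Qed.

Lemma dval_geW m n x : m <= n -> dval_ge v n x -> dval_ge v m x.
Proof. by move=> mn [->|nx]; [left|right; exact: le_trans nx]. Qed.

Lemma dval_geE n x : x != 0 -> dval_ge v n x -> n <= v x.
Proof. by move=> /eqP x0 []. Qed.

Lemma dval_geN n x : dval_ge v n x -> dval_ge v n (- x).
Proof.
have [->|x0] := eqVneq x 0; first by rewrite oppr0.
by move/(dval_geE x0) => nx; right; rewrite dvalN.
Qed.

Lemma dval_geD n x y : dval_ge v n x -> dval_ge v n y -> dval_ge v n (x + y).
Proof.
have [->|x0] := eqVneq x 0; first by rewrite add0r.
have [->|y0] := eqVneq y 0; first by rewrite addr0.
move=> /(dval_geE x0) nx /(dval_geE y0) ny.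
have [xy0|xy0] := eqVneq (x + y) 0; [by left|right].
by apply: le_trans (dvalD v x0 y0 xy0); rewrite le_min nx ny.
Qed.

Lemma dval_geB n x y : dval_ge v n x -> dval_ge v n y -> dval_ge v n (x - y).
Proof. by move=> nx /dval_geN; exact: dval_geD. Qed.

Lemma dval_ge_sum n (I : Type) (r : seq I) (P : pred I) (F : I -> k) :
  (forall i, P i -> dval_ge v n (F i)) -> dval_ge v n (\sum_(i <- r | P i) F i).
Proof. by move=> nF; apply: big_ind nF; [left|exact: dval_geD]. Qed.

Lemma dval_geM m n x y : dval_ge v m x -> dval_ge v n y -> dval_ge v (m + n) (x * y).
Proof.
have [->|x0] := eqVneq x 0; first by rewrite mul0r; left.
have [->|y0] := eqVneq y 0; first by rewrite mulr0; left.
by move=> /(dval_geE x0) mx /(dval_geE y0) ny; right; rewrite dvalM // lerD.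
Qed.

Lemma dval_geX n x i : (0 < i)%N -> dval_ge v n x -> dval_ge v (n *+ i) (x ^+ i).
Proof.
move=> i0; have [->|x0] := eqVneq x 0.
  by rewrite expr0n gtn_eqF //; left.
by move/(dval_geE x0) => nx; right; rewrite dvalX // lerMn2r nx orbT.
Qed.

Lemma dval_ge_eq0 x : (forall n, dval_ge v n x) -> x = 0.
Proof.
move=> xn; apply/eqP/negP => /negP x0; have := dval_geE x0 (xn (v x + 1)).
by rewrite gerDl.
Qed.

Lemma dvalDl x y : x != 0 -> dval_ge v (v x + 1) y -> x + y != 0 /\ v (x + y) = v x.
Proof.
move=> x0 yx; have xy0 : x + y != 0.
  apply/negP; rewrite addr_eq0 => /eqP xy.
  have : v x + 1 <= v x; last by rewrite gerDl.
  by apply: (dval_geE x0); rewrite {2}xy; exact: dval_geN.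
split=> //; apply/eqP; rewrite eq_le; apply/andP; split; last first.
  apply: (dval_geE xy0); apply: dval_geD; first exact: dval_ge_id.
  by apply: dval_geW yx; rewrite lerDl.
rewrite leNgt; apply/negP; rewrite -lezD1 => lt.
have : v x + 1 <= v x; last by rewrite gerDl.
apply: (dval_geE x0); rewrite -{2}[x](addrK y); apply: dval_geB => //.
by apply: dval_geW lt (dval_ge_id _).
Qed.

Lemma dval_bound (I : finType) (F : I -> k) :
  exists C : nat, forall i, dval_ge v (- C%:Z) (F i).
Proof.
exists (\max_i `|v (F i)|)%N => i; apply: dval_geW (dval_ge_id _).
have : (`|v (F i)| <= \max_i `|v (F i)|)%N.
  exact: (leq_bigmax (F := fun i => `|v (F i)|%N)).
by set M := (\max_i _)%N; lia.
Qed.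

Lemma dval_mx_bound (i j : nat) (A : 'M[k]_(i, j)) :
  exists C : nat, forall a b, dval_ge v (- C%:Z) (A a b).
Proof.
have [C CP] := dval_bound (fun ab : 'I_i * 'I_j => A ab.1 ab.2).
by exists C => a b; exact: (CP (a, b)).
Qed.

Lemma dval_ge_mulmx m n i j l (A : 'M[k]_(i, j)) (B : 'M_(j, l)) :
  (forall a b, dval_ge v m (A a b)) -> (forall a b, dval_ge v n (B a b)) ->
  forall a b, dval_ge v (m + n) ((A *m B) a b).
Proof.
by move=> mA nB a b; rewrite mxE; apply: dval_ge_sum => c _; exact: dval_geM.
Qed.

Section Characteristic.
Variables (p : nat) (chark : p \in [pchar k]).
Let p_gt1 : (1 < p)%N := prime_gt1 (pcharf_prime chark).

Lemma dval_ge_Frob n i j (A : 'M[k]_(i, j)) :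
  (forall a b, dval_ge v n (A a b)) ->
  forall a b, dval_ge v (n *+ p) (Frob chark A a b).
Proof.
move=> nA a b; rewrite mxE pFrobenius_autE.
by apply: dval_geX => //; exact: ltnW.
Qed.

(* Where y has its worst pole, of order N, y^p has a pole of order p N, so that
   N is bounded; but the pole of eta, of order prime to p, cannot be
   compensated by that of y_0^p. *)
Lemma twisted_AS_obstruction (n : nat) (i0 : 'I_n) (Phi : 'M[k]_n) : Phi \in unitmx ->
  exists J0 : nat, forall (J : nat) (eta : k) (y : 'rV[k]_n), (J0 <= J)%N -> eta != 0 ->
    v eta = 1 - (p * J)%N%:Z ->
    eta *: (delta_mx 0 i0 *m Phi) <> Frob chark y *m Phi - y.
Proof.
move=> uPhi; have [C CP] := dval_mx_bound (invmx Phi).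
(* The bounds [N1] and [NC] below yield pJ <= 2C + 1, which this choice excludes. *)
exists (2 * C + 2)%N => J eta y J0J eta0 veta Heta.
(* Inverting [Phi] confines [eta] to the coordinate [i0], at the price of [C] in the valuation of
   the right-hand side. *)
have yE : Frob chark y - eta *: delta_mx 0 i0 = y *m invmx Phi.
  apply: (can_inj (mulmxK uPhi)); rewrite mulmxKV // mulmxBl -scalemxAl Heta.
  by rewrite opprB addrC subrK.
have [y0|y0] := eqVneq y 0.
  move: yE; rewrite y0 mul0mx /Frob map_mx0 sub0r => /matrixP/(_ 0 i0)/eqP.
  by rewrite !mxE !eqxx mulr1 oppr_eq0 (negPf eta0).
have [j yj0 ymin] : exists2 j, y 0 j != 0 & forall i, dval_ge v (v (y 0 j)) (y 0 i).
  have /matrix0Pn[a [i yi]] := y0; rewrite (ord1 a) in yi.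
  case: (arg_minP (P := fun i => y 0 i != 0) (fun i => v (y 0 i)) yi) => j yj jmin.
  exists j => // l.
  by have [->|yl0] := eqVneq (y 0 l) 0; [left|right; exact: jmin].
set N := v (y 0 j) in ymin.
have yPsi i : dval_ge v (N - C%:Z) ((y *m invmx Phi) 0 i).
  apply: dval_ge_mulmx CP _ _ => a b; rewrite (ord1 a); exact: ymin.
have coef i : (y *m invmx Phi) 0 i = y 0 i ^+ p - eta * (i == i0)%:R.
  by rewrite -yE !mxE pFrobenius_autE eqxx.
have p_ge0 : 0 <= p%:Z by [].
have le_lt (a b : int) : a < 1 - b -> (a + b) * p%:Z <= 0.
  by move=> ab; rewrite mulr_le0_ge0 //; move: ab; clear; lia.
have le_ge (a b : int) : 1 - b <= a -> 0 <= (a + b - 1) * p%:Z.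
  by move=> ab; rewrite mulr_ge0 //; move: ab; clear; lia.
(* The valuation of a nonzero p-th power is divisible by p and that of [eta] is 1 modulo p, so they
   never cancel. *)
have eta_le i : y 0 i ^+ p - eta != 0 /\ v (y 0 i ^+ p - eta) <= 1 - (p * J)%N%:Z.
  have [->|yi0] := eqVneq (y 0 i) 0.
    by rewrite expr0n gtn_eqF 1?ltnW // sub0r oppr_eq0 dvalN // veta.
  have vyp : v (y 0 i ^+ p) = v (y 0 i) * p%:Z by rewrite dvalX // -mulr_natr natz.
  have [lt|ge] := ltP (v (y 0 i)) (1 - J%:Z).
    have [||ne ->] := @dvalDl (y 0 i ^+ p) (- eta); first by rewrite expf_neq0.
      by right; rewrite dvalN // veta vyp; move: (le_lt _ _ lt); clear; lia.
    by split=> //; rewrite vyp; move: (le_lt _ _ lt); clear; lia.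
  rewrite addrC; have [||ne ->] := @dvalDl (- eta) (y 0 i ^+ p).
  - by rewrite oppr_eq0.
  - by right; rewrite dvalN // veta vyp; move: (le_ge _ _ ge) p_gt1; clear; lia.
  by split=> //; rewrite dvalN // veta.
have N1 : N <= 1 - (p * J)%N%:Z + C%:Z.
  have [ne le] := eta_le i0; have := yPsi i0; rewrite coef eqxx mulr1.
  by move/(dval_geE ne); lia.
have N2 : N - C%:Z <= N * p%:Z.
  have vyp : v (y 0 j ^+ p) = N * p%:Z by rewrite dvalX // -mulr_natr natz.
  have yp0 : y 0 j ^+ p != 0 by rewrite expf_neq0.
  rewrite -vyp; apply: (dval_geE yp0); have := yPsi j; rewrite coef.
  have [->|_] := eqVneq j i0; last by rewrite mulr0 subr0.
  rewrite mulr1 => H; rewrite -[_ ^+ p](subrK eta); apply: dval_geD => //.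
  by right; rewrite veta; move: N1; clear; lia.
have NC : - C%:Z <= N.
  rewrite leNgt; apply/negP => NC.
  have : 0 <= (p%:Z - 2) * - N by rewrite mulr_ge0 //; move: NC p_gt1; clear; lia.
  by move: N2 NC; clear; lia.
have pJ : (2 * J <= p * J)%N by rewrite leq_mul2r p_gt1 orbT.
by move: N1 NC J0J pJ; clear; lia.
Qed.

End Characteristic.
End Valuation.

(* The solution is the limit of e <- Frob e * Phi - delta. *)
Lemma twisted_AS_small (k : fieldType) (v : dvaluation k) (K : completion v)
    p (charK : p \in [pchar K]) n (Phi : 'M[K]_n) :
  exists B : nat, forall delta : 'rV[K]_n,
    (forall i, dval_ge (compl_val K) B%:Z (delta 0 i)) ->
    exists e, Frob charK e *m Phi - e = delta.
Proof.
set V := compl_val K; have p_gt1 := prime_gt1 (pcharf_prime charK).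
(* From valuation C + 1 + N, Frobenius multiplies by p >= 2 and [Phi] loses at most [C]: each
   iteration gains at least 1. *)
have [C CP] := dval_mx_bound V Phi; exists C.+1 => delta dB.
have step N (x : 'rV[K]_n) : (forall a i, dval_ge V (C.+1 + N)%:Z (x a i)) ->
    forall a i, dval_ge V (C.+1 + N.+1)%:Z ((Frob charK x *m Phi) a i).
  move=> xN a i; have := dval_ge_mulmx (dval_ge_Frob charK xN) CP a i.
  by apply: dval_geW; rewrite -mulr_natr; nia.
pose e := fix e j := if j is j'.+1 then Frob charK (e j') *m Phi - delta else 0.
have eS j : e j.+1 = Frob charK (e j) *m Phi - delta by [].
have ediff j a i : dval_ge V (C.+1 + j)%:Z ((e j.+1 - e j) a i).
  elim: j a i => [|j IH] a i.
    rewrite eS /= /Frob map_mx0 mul0mx sub0r subr0 mxE; apply: dval_geN.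
    by rewrite (ord1 a) addn0; exact: dB.
  rewrite [e j.+2]eS {2}eS opprB addrA subrK -mulmxBl -FrobB.
  exact: step.
have ecauchy j l a i : dval_ge V (C.+1 + j)%:Z ((e (j + l)%N - e j) a i).
  elim: l => [|l IH]; first by rewrite addn0 subrr mxE; left.
  rewrite -[e (j + l.+1)%N](subrK (e (j + l)%N)) -addrA [(_ + _ : 'M_(_, _)) a i]mxE.
  apply: dval_geD => //; rewrite addnS; apply: dval_geW (ediff _ _ _).
  by rewrite lez_nat leq_add2l leq_addr.
have /choice[l lP] : forall i : 'I_n, exists l, dval_cvg V (fun j => e j 0 i) l.
  move=> i; apply: compl_complete => N; exists `|N|%N => a b Na Nb.
  wlog ab : a b Na Nb / (a <= b)%N.
    move=> H; have [/H|/ltnW ba] := leqP a b; first exact.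
    by rewrite -opprB; apply: dval_geN; exact: H.
  rewrite -opprB; apply: dval_geN; rewrite -(subnKC ab).
  have := ecauchy a (b - a)%N 0 i; rewrite !mxE; apply: dval_geW.
  by move: Na; clear; lia.
exists (\row_i l i); set w := \row_i l i.
have wP (N : nat) : exists M, forall j, (M <= j)%N -> forall a i,
    dval_ge V (C.+1 + N)%:Z ((w - e j) a i).
  have /choice[M MP] := fun i => lP i (C.+1 + N)%:Z.
  exists (\max_i M i)%N => j Mj a i; rewrite (ord1 a) -opprB.
  rewrite mxE; apply: dval_geN; rewrite !mxE; apply: MP.
  by apply: leq_trans Mj; exact: (leq_bigmax i).
apply/eqP; rewrite -subr_eq0; apply/eqP/matrixP => a i; rewrite [RHS]mxE.
apply: (dval_ge_eq0 (v := V)) => N; have [M MP] := wP `|N|%N.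
have -> : Frob charK w *m Phi - w - delta =
    Frob charK (w - e M) *m Phi - (w - e M.+1).
  rewrite FrobB mulmxBl eS opprB -!addrA; congr (_ + _).
  by rewrite addKr addrC.
rewrite [(_ + _ : 'M_(_, _)) a i]mxE [X in _ + X]mxE; apply: dval_geB.
  apply: dval_geW (step `|N|%N _ _ a i); last exact: MP.
  by clear; lia.
by apply: dval_geW (MP _ (leqnSn _) _ _); clear; lia.
Qed.

(** * Weak approximation for inequivalent discrete valuations *)

Section WeakApproximation.
Variable k : fieldType.
Implicit Types v w : dvaluation k.

(** A discrete valuation ring is a maximal proper subring. If w x >= 0 > v x and w y = -1, then y /
    x^m with m large is integral for [v] but not for [w]. *)
Lemma dval_incl_equiv v w :
  (forall x : k, x != 0 -> 0 <= v x -> 0 <= w x) -> dval_equiv v w.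
Proof.
move=> vw x x0; apply/idP/idP; first exact: vw.
move=> wx; rewrite leNgt; apply/negP => vx.
have [y y0 wy] := dval_surj w (-1).
pose m := (`|v y| + 1)%N.
have z0 : (x ^+ m * y^-1)^-1 != 0 by rewrite invr_eq0 mulf_neq0 ?expf_neq0 ?invr_eq0.
have vz (u : dvaluation k) : u (x ^+ m * y^-1)^-1 = u y - u x *+ m.
  by rewrite dvalV ?mulf_neq0 ?expf_neq0 ?invr_eq0 // dvalM ?expf_neq0 ?invr_eq0 //
    dvalV // dvalX // opprD opprK addrC.
have : 0 <= w (x ^+ m * y^-1)^-1.
  apply: vw => //; rewrite vz -mulr_natr /m; nia.
by rewrite vz wy -mulr_natr; nia.
Qed.

Lemma dval_separate v w : ~ dval_equiv v w ->
  exists x, [/\ x != 0, 0 < v x & w x < 0].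
Proof.
move=> vw.
have [x [x0 vx wx]] : exists x, [/\ x != 0, 0 <= v x & w x < 0].
  apply: contrapT => no; apply: vw; apply: dval_incl_equiv => x x0 vx.
  by rewrite leNgt; apply/negP => wx; apply: no; exists x.
have [y [y0 vy wy]] : exists y, [/\ y != 0, v y < 0 & 0 <= w y].
  apply: contrapT => no; apply: vw => x' x'0; symmetry; move: x' x'0.
  apply: dval_incl_equiv => z z0 wz.
  by rewrite leNgt; apply/negP => vz; apply: no; exists z.
exists (x / y); rewrite !dvalM ?dvalV ?mulf_neq0 ?invr_eq0 //.
by split=> //; lia.
Qed.

Variables (I : finType) (v : I -> dvaluation k).
Hypothesis v_inequiv : forall i j, i <> j -> ~ dval_equiv (v i) (v j).

(** [x] serves [r] and [y] separates [i] from [j]. If v_j x <= 0, x^m y serves both; otherwise y (1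
    + x^m) does, since 1 + x^m is a unit at [i] and [j] and has a large pole at each member of
    [r]. *)
Lemma dval_separate_all i (r : seq I) : i \notin r ->
  exists x : k, [/\ x != 0, 0 < v i x & {in r, forall j, v j x < 0}].
Proof.
elim: r => [_|j r IH].
  by have [x x0 vx] := dval_surj (v i) 1; exists x; rewrite vx.
rewrite inE negb_or => /andP[/eqP ij /IH[x [x0 vx rx]]].
have [y [y0 vy wy]] := dval_separate (v_inequiv ij).
pose m := (\max_(l <- r) `|v l y| + 1)%N.
have mP l : l \in r -> v l y + v l x *+ m < 0.
  move=> lr; have := rx l lr; have : (`|v l y| <= \max_(l <- r) `|v l y|)%N.
    by rewrite (big_rem l) //= leq_maxl.
  by rewrite -mulr_natr /m; nia.
have m0 : (0 < m)%N by rewrite /m addn1.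
have xm0 : x ^+ m != 0 by rewrite expf_neq0.
have [vjx|vjx] := leP (v j x) 0.
  exists (x ^+ m * y); split; first by rewrite mulf_neq0.
    by rewrite dvalM // dvalX // -mulr_natr; nia.
  move=> l; rewrite dvalM // dvalX // inE => /predU1P[->|/mP]; last by rewrite addrC.
  by rewrite -mulr_natr; nia.
have V1 l : 0 < v l x -> 1 + x ^+ m != 0 /\ v l (1 + x ^+ m) = 0.
  move=> lx; have [||? ->] := @dvalDl _ (v l) 1 (x ^+ m); rewrite ?oner_neq0 ?dval1 //.
  by right; rewrite add0r dvalX // -mulr_natr; nia.
have [x1 vix1] := V1 i vx; have [_ vjx1] := V1 j vjx.
exists (y * (1 + x ^+ m)); split; first by rewrite mulf_neq0.
  by rewrite dvalM // vix1 addr0.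
move=> l; rewrite dvalM // inE => /predU1P[->|lr]; first by rewrite vjx1 addr0.
rewrite [1 + _]addrC; have [|? ->] := @dvalDl _ (v l) (x ^+ m) 1 xm0.
  by right; rewrite dval1 dvalX // -mulr_natr; have := rx l lr; nia.
by rewrite dvalX //; exact: mP.
Qed.

(** With [x] small at [i] and having poles elsewhere, 1/(1 + x^m) is near 1 at [i] and near 0 at the
    other valuations. The exponent [m] also makes up for the poles of the [d i], of order at most
    [C]. *)
Lemma weak_approximation (d : I -> k) (B : int) :
  exists c, forall i, dval_ge (v i) B (c - d i).
Proof.
have [C CP] : exists C : nat, forall i j, dval_ge (v i) (- C%:Z) (d j).
  have /choice[C CP] := fun i => dval_bound (v i) d.
  exists (\max_i C i)%N => i j; apply: dval_geW (CP i j).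
  by rewrite lerN2 lez_nat; exact: (leq_bigmax i).
pose m := (`|B| + C + 1)%N.
have /choice[e eP] : forall i, exists e : k, dval_ge (v i) m%:Z (e - 1) /\
    forall j, j <> i -> dval_ge (v j) m%:Z e.
  move=> i; have [|x [x0 vx rx]] := @dval_separate_all i (enum (predC1 i)).
    by rewrite mem_enum inE eqxx.
  have xm0 : x ^+ m != 0 by rewrite expf_neq0.
  have [||x1 vx1] := @dvalDl _ (v i) 1 (x ^+ m); rewrite ?oner_neq0 ?dval1 //.
    by right; rewrite add0r dvalX // -mulr_natr /m; nia.
  exists (1 + x ^+ m)^-1; split.
    have -> : (1 + x ^+ m)^-1 - 1 = - (x ^+ m / (1 + x ^+ m)).
      apply: (mulIf x1); rewrite mulrBl mulVf // mul1r mulNr mulfVK //.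
      by rewrite opprD addrA subrr add0r.
    apply: dval_geN; right; rewrite dvalM ?invr_eq0 // dvalV // vx1 dval1 subr0.
    by rewrite dvalX // -mulr_natr; nia.
  move=> j /eqP ji; right; rewrite dvalV //.
  have vj : v j x < 0 by apply: rx; rewrite mem_enum inE.
  rewrite [1 + _]addrC; have [|? ->] := @dvalDl _ (v j) (x ^+ m) 1 xm0.
    by right; rewrite dval1 dvalX // -mulr_natr /m; nia.
  by rewrite dvalX // -mulr_natr; nia.
exists (\sum_i e i * d i) => i; rewrite (bigD1 i) //= addrAC.
have mC : B <= m%:Z - C%:Z by rewrite /m; lia.
apply: dval_geD.
  rewrite -{2}[d i]mul1r -mulrBl; apply: dval_geW mC _.
  by apply: dval_geM => //; have [] := eP i.
apply: dval_ge_sum => j /eqP ji; apply: dval_geW mC _.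
by apply: dval_geM => //; have [_] := eP j; apply; exact/nesym.
Qed.

End WeakApproximation.

Lemma dvaluation_avoid (k : fieldType) (S : finType) (v : S -> dvaluation k) :
  infinitely_many_dvaluations k -> exists u, forall s, ~ dval_equiv u (v s).
Proof.
move=> [u uP]; apply: contrapT => no.
have /choice[f fP] : forall m, exists s, dval_equiv (u m) (v s).
  move=> m; apply: contrapT => nos; apply: no; exists (u m) => s us.
  by apply: nos; exists s.
have /injectivePn[a [b ab fab]] : ~~ injectiveb (fun m : 'I_(#|S|.+1) => f m).
  by apply/injectiveP => /leq_card; rewrite card_ord ltnn.
apply: (uP a b); first by move/val_inj/eqP; rewrite (negPf ab).
by move=> x x0; rewrite fP // fab -fP.
Qed.

(** * Extensions by a vector group over the prime field *)

Lemma compl_dval_ge (k : fieldType) (v : dvaluation k) (K : completion v) n x :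
  dval_ge v n x -> dval_ge (compl_val K) n (compl_in K x).
Proof.
have [->|x0] := eqVneq x 0; first by rewrite rmorph0; left.
by move/(dval_geE x0) => nx; right; rewrite compl_valE.
Qed.

Section LinearProblem.
Variables (k : fieldType) (p : nat) (chark : p \in [pchar k]) (E : sepClosure k).
Variables (n : nat) (R : Gal E -> 'M['F_p]_n).
Variables (C : Gal E -> Gal E -> 'rV['F_p]_n) (r : seq E).
Hypotheses (R_unit : forall s, R s \in unitmx) (Rr : loc_const r R).
Hypothesis RM : forall s t, R (s * t)%g = R t *m R s.
Hypotheses (Cr1 : forall s, loc_const r (C s)) (Cr2 : forall t, loc_const r (C^~ t)).
Hypothesis CM : forall g h q,
  C g h + C (g * h)%g q = C h q *m R g + C g (h * q)%g.

(* For an extension by 'F_p^n with action R and factor set C relative to the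
   lifts tau, this says that s |-> m(s) tau(s) is a homomorphism. *)
Definition linear_solution (m : Gal E -> 'rV['F_p]_n) : Prop :=
  forall s t, m (s * t)%g = m s + m t *m R s + C s t.

Let charE : p \in [pchar E] := rmorph_pchar (sepc_in E) chark.
Local Notation j := (Fp_in charE).
Local Notation Fr := (Frob charE).
Local Notation inE := (map_mx (sepc_in E)).
Let A s := map_mx j (R s).

(* P is a basis of E^n invariant under the twisted action, Phi the matrix of
   Frobenius in it, and m c the solution attached to the root w c of the
   Artin-Schreier equation with parameter c. *)
Definition solution_family (P : 'M[E]_n) (Phi : 'M[k]_n)
    (b : Gal E -> 'rV[E]_n) (a0 : 'rV[E]_n)
    (w : 'rV[k]_n -> 'rV[E]_n) (m : 'rV[k]_n -> Gal E -> 'rV['F_p]_n) : Prop :=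
  [/\ [/\ P \in unitmx, Phi \in unitmx, forall s, tact A s P = P & Fr P = inE Phi *m P],
      [/\ exists rb, loc_const rb b,
          forall s t, b (s * t)%g = b s + tact A s (b t) + map_mx j (C s t) &
          forall s, Fr (b s) - b s = a0 - tact A s a0],
      forall c, Fr (w c) - w c = a0 + inE c *m P &
      forall c s, map_mx j (m c s) = b s - (w c - tact A s (w c))].

Let A_fix (s t : Gal E) : map_mx s (A t) = A t.
Proof. exact: map_mx_Fp. Qed.

Let AM (s t : Gal E) : A (s * t)%g = A t *m A s.
Proof. by rewrite /A RM map_mxM. Qed.

Let A_unit (s : Gal E) : A s \in unitmx.
Proof. by rewrite /A map_unitmx. Qed.

Let Ar : loc_const r A.
Proof. by move=> s t st; rewrite /A (Rr st). Qed.

Let Fr_tact s l (x : 'M_(l, n)) : Fr (tact A s x) = tact A s (Fr x).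
Proof. by apply: Frob_tact; rewrite Frob_Fp. Qed.

(** Frobenius commutes with the twisted action, so Frob P is invariant and [Phi] has entries in k.
    Since [c P] is invariant, [b] minus the coboundary of [w c] is fixed by Frobenius and takes
    values in 'F_p. *)
Lemma solution_family_exists : exists P Phi b a0 w m, solution_family P Phi b a0 w m.
Proof.
have [|||b' [rb b'r] b'P] := @twisted_H2 _ _ _ A r (fun s t => map_mx j (C s t)).
- by move=> s t t' tt'; congr map_mx; exact: Cr1 tt'.
- by move=> s t t' tt'; congr map_mx; exact: (@Cr2 s t t' tt').
- by move=> g h q; rewrite /tact map_mx_Fp -map_mxM -!map_mxD CM.
pose b s := - b' s.
have bM s t : b (s * t)%g = b s + tact A s (b t) + map_mx j (C s t).
  rewrite b'P /b raddfN /=; move: (tact _ _ _) (b' s) (b' (s * t)%g) => x y z.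
  by apply/matrixP => ? ?; rewrite !mxE; ring.
have br : loc_const rb b by move=> s t st; rewrite /b (b'r _ _ st).
have [||a0 a0P] := @twisted_H1 _ _ _ A rb (fun s => Fr (b s) - b s).
- by move=> s t st; rewrite (br _ _ st).
- move=> s t; rewrite bM !FrobD Fr_tact tactB Frob_Fp.
  move: (b s) (Fr (b s)) (tact A s (b t)) (tact A s (Fr (b t))).
  move: (map_mx j _) => x y z u u'.
  by apply/matrixP => ? ?; rewrite !mxE; ring.
have [P uP PP] := tact_invariant_basis A_fix AM A_unit Ar.
have [|Phi PhiP] := @tact_fixed _ _ _ A P n (Fr P) uP PP.
  by move=> s; rewrite -Fr_tact PP.
have uPhi : Phi \in unitmx.
  have : Fr P \in unitmx by rewrite /Frob map_unitmx.
  by rewrite PhiP unitmx_mul map_unitmx => /andP[].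
have /choice[w wP] : forall c : 'rV[k]_n, exists w, Fr w - w = a0 + inE c *m P.
  by move=> c; exact: artin_schreier.
have /choice[m mP] : forall cs : 'rV[k]_n * Gal E, exists m,
    map_mx j m = b cs.2 - (w cs.1 - tact A cs.2 (w cs.1)).
  move=> [c s] /=.
  have [|m mE] := @Frob_fixed _ _ charE _ _ (b s - (w c - tact A s (w c))); last by exists m.
  apply/eqP; rewrite -subr_eq0 !FrobB Fr_tact.
  have -> (x y z x' y' z' : 'rV[E]_n) :
    x - (y - z) - (x' - (y' - z')) = (x - x') - ((y - y') - (z - z')).
    by apply/matrixP => ? ?; rewrite !mxE; ring.
  rewrite a0P -tactB wP tactD tact_base //.
  move: (tact A s a0) (_ *m P) => x y.
  by apply/eqP/matrixP => ? ?; rewrite !mxE; ring.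
exists P, Phi, b, a0, w, (fun c s => m (c, s)).
split; [by []| |by []|by move=> c s; exact: mP (c, s)].
by split=> //; exists rb.
Qed.

Section Family.
Variables (P : 'M[E]_n) (Phi : 'M[k]_n) (b : Gal E -> 'rV[E]_n) (a0 : 'rV[E]_n).
Variables (w : 'rV[k]_n -> 'rV[E]_n) (m : 'rV[k]_n -> Gal E -> 'rV['F_p]_n).
Hypothesis fam : solution_family P Phi b a0 w m.

(** Subtracting a coboundary from [b] leaves its defect [C] unchanged. *)
Lemma family_solution c : linear_solution (m c).
Proof.
have [_ [_ bM _] _ mP] := fam; move=> s t; apply: (@map_mx_inj _ _ j).
rewrite !map_mxD map_mxM !mP bM (tactM A_fix AM) -/(A s).
have -> : (b t - (w c - tact A t (w c))) *m A s =
    map_mx s (map_mx j (m c t)) *m A s by rewrite map_mx_Fp mP.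
rewrite mP -/(tact A s _) !tactB.
move: (tact A s (b t)) (tact A s (w c)) (tact A s (tact A t _)) (map_mx j _) => x y z u.
by move: (b s) (w c) => x' y'; apply/matrixP => ? ?; rewrite !mxE; ring.
Qed.

Lemma family_loc_const c : exists r', loc_const r' (m c).
Proof.
have [_ [[rb br] _ _] _ mP] := fam.
exists (r ++ rb ++ [seq w c 0 i | i <- enum 'I_n]) => s t st.
apply: (@map_mx_inj _ _ j); rewrite !mP; congr (_ - (_ - _)).
  by apply: br => x xr; apply: st; rewrite !mem_cat xr orbT.
rewrite /tact (_ : A s = A t); last first.
  by apply: Ar => x xr; apply: st; rewrite mem_cat xr.
congr (_ *m _); apply/matrixP => a i; rewrite !mxE (ord1 a); apply: st.
by rewrite !mem_cat (map_f (fun i => w c 0 i)) ?mem_enum ?orbT.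
Qed.

(** Equality makes [w c - w c'] invariant, of the form y P with [y] over k; Frob - 1 is then applied
    to it. *)
Lemma family_eq c c' : m c = m c' -> exists y, c - c' = Frob chark y *m Phi - y.
Proof.
have [[uP uPhi PP PhiP] _ wP mP] := fam => mcc'.
have [|y yP] := @tact_fixed _ _ _ A P 1 (w c - w c') uP PP.
  move=> s; have := mP c s; rewrite mcc' mP tactB.
  move: (b s) (w c) (w c') (tact A s (w c)) (tact A s (w c')) => x1 x2 x3 x4 x5 Hx.
  apply/eqP; rewrite -subr_eq0 -[X in _ == X](subrr (x1 - (x3 - x5))) {1}Hx.
  by apply/eqP/matrixP => ? ?; rewrite !mxE; ring.
exists y; apply: (@map_mx_inj _ _ (sepc_in E)); apply: (can_inj (mulmxK uP)).
rewrite !map_mxB map_mxM (map_mx_Frob chark charE) !mulmxBl -mulmxA -PhiP -FrobM -yP.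
have -> : inE c *m P - inE c' *m P = (a0 + inE c *m P) - (a0 + inE c' *m P).
  by rewrite [a0 + _]addrC addrKA.
rewrite -!wP FrobB; move: (w c) (w c') (Fr (w c)) (Fr (w c')) => x1 x2 x3 x4.
by apply/matrixP => ? ?; rewrite !mxE; ring.
Qed.

(** * Comparison with a prescribed solution over a completion *)

Section Local.
Variables (v : dvaluation k) (K : completion v) (F : sepClosure K).
Variables (iota : {rmorphism E -> F}) (phi : Gal F -> Gal E).
Hypothesis iota_k : forall a, iota (sepc_in E a) = sepc_in F (compl_in K a).
Hypothesis phiM : {morph phi : x y / (x * y)%g}.
Hypothesis phi_iota : forall x u, iota (phi x u) = x (iota u).
Variables (ml : Gal F -> 'rV['F_p]_n) (rl : seq F).
Hypothesis mlr : loc_const rl ml.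
Hypothesis mlM : forall x y,
  ml (x * y)%g = ml x + ml y *m R (phi x) + C (phi x) (phi y).

Let charK : p \in [pchar K] := rmorph_pchar (compl_in K) chark.
Let charF : p \in [pchar F] := rmorph_pchar (sepc_in F) charK.
Local Notation jF := (Fp_in charF).
Local Notation FrF := (Frob charF).
Local Notation inF := (map_mx (sepc_in F)).
Local Notation io := (map_mx iota).
Let AF x := map_mx jF (R (phi x)).

Let io_tact x l (u : 'M_(l, n)) : io (tact A (phi x) u) = tact AF x (io u).
Proof.
rewrite /tact map_mxM (map_mx_Fp charE charF); congr (_ *m _).
by apply/matrixP => ? ?; rewrite !mxE phi_iota.
Qed.

Let FrF_tact x l (u : 'M_(l, n)) : FrF (tact AF x u) = tact AF x (FrF u).
Proof. by apply: Frob_tact; rewrite Frob_Fp. Qed.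

Let io_Fr l (u : 'M_(l, n)) : io (Fr u) = FrF (io u).
Proof. exact: map_mx_Frob. Qed.

Let io_in l (u : 'M[k]_(l, n)) : io (inE u) = inF (map_mx (compl_in K) u).
Proof. by apply/matrixP => ? ?; rewrite !mxE iota_k. Qed.

Let tact_jF x (u : 'rV['F_p]_n) : tact AF x (map_mx jF u) = map_mx jF (u *m R (phi x)).
Proof. by rewrite /tact map_mx_Fp map_mxM. Qed.

Lemma local_Artin_Schreier : exists ws d,
  (forall x, map_mx jF (ml x) = io (b (phi x)) - (ws - tact AF x ws)) /\
  FrF ws - ws = io a0 + inF d *m io P.
Proof.
have [[uP uPhi PP PhiP] [[rb br] bM bz] wP mP] := fam.
pose z x := map_mx jF (ml x) - io (b (phi x)).
have [||w' w'P] := @twisted_H1 _ _ _ AF (rl ++ map iota rb) z.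
- move=> x y xy; rewrite /z (mlr (t := y)); last first.
    by move=> u ur; apply: xy; rewrite mem_cat ur.
  rewrite (br (phi x) (phi y)) // => u ur; apply: (fmorph_inj iota).
  by rewrite !phi_iota; apply: xy; rewrite mem_cat map_f ?orbT.
- move=> x y; rewrite /z phiM mlM bM !map_mxD tactB tact_jF io_tact.
  rewrite (map_mx_Fp charE charF) !map_mxM.
  move: (io _) (tact _ _ _) (map_mx jF (ml x)) (map_mx jF (C _ _)) => x1 x2 x3 x4.
  by move: (_ *m _) => x5; apply/matrixP => ? ?; rewrite !mxE; ring.
pose ws := - w'.
have mlE x : map_mx jF (ml x) = io (b (phi x)) - (ws - tact AF x ws).
  rewrite /ws raddfN /= -opprD opprK -w'P /z.
  by rewrite addrC subrK.
have uiP : io P \in unitmx by rewrite map_unitmx.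
have iPP x : tact AF x (io P) = io P by rewrite -io_tact PP.
have [|d dP] := @tact_fixed _ _ _ AF (io P) 1 (FrF ws - ws - io a0) uiP iPP.
  move=> x; have := Frob_Fp charF (ml x); rewrite mlE => /eqP; rewrite -subr_eq0 => /eqP.
  rewrite !FrobB !tactB FrF_tact -io_Fr -(io_tact x a0).
  have : io (Fr (b (phi x))) - io (b (phi x)) = io a0 - io (tact A (phi x) a0).
    by rewrite -!map_mxB bz.
  move: (tact AF x ws) (tact AF x (FrF ws)).
  move: (io (b _)) (io (Fr (b _))) (io a0) (io (tact _ _ _)) (ws) (FrF ws).
  move=> y1 y2 y3 y4 y5 y6 x7 x8 Hx Hy.
  apply/eqP; rewrite -subr_eq0 -[X in _ == X]Hy.
  have -> : y2 = y3 - y4 + y1 by rewrite -Hx subrK.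
  by apply/eqP/matrixP => ? ?; rewrite !mxE; ring.
by exists ws, d; split=> //; rewrite -dP [RHS]addrC subrK.
Qed.

(** For [c] near [d], d - c = Frob e Phi - e with [e] over the completion. Then ws - w c - e P is
    fixed by Frobenius: it is the conjugating vector [mu], and the invariant e P drops out of the
    coboundary. *)
Lemma local_match : exists (d : 'rV[K]_n) (B : nat), forall c : 'rV[k]_n,
  (forall i, dval_ge (compl_val K) B%:Z (d 0 i - compl_in K (c 0 i))) ->
  exists mu, forall x, m c (phi x) = mu + ml x - mu *m R (phi x).
Proof.
have [[uP uPhi PP PhiP] _ wP mP] := fam.
have [ws [d [mlE wsE]]] := local_Artin_Schreier.
have [B BP] := twisted_AS_small charK (map_mx (compl_in K) Phi).
exists d, B => c cB; have [|e eE] := BP (d - map_mx (compl_in K) c).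
  by move=> i; rewrite !mxE.
pose eP := inF e *m io P.
have ePE : FrF eP - eP = inF d *m io P - io (inE c *m P).
  rewrite map_mxM io_in -!mulmxBl -map_mxB -eE /eP FrobM -io_Fr PhiP map_mxM io_in.
  by rewrite mulmxA -mulmxBl map_mxB map_mxM (map_mx_Frob charK charF).
have [|mu muP] := @Frob_fixed _ _ charF _ _ (ws - io (w c) - eP).
  have : io (Fr (w c)) - io (w c) = io a0 + io (inE c *m P).
    by rewrite -map_mxB -map_mxD wP.
  move: wsE ePE; rewrite !FrobB -io_Fr; move: (io (Fr _)) (io (w c)) (FrF ws) (FrF eP).
  move: (inF d *m _) (io (_ *m _)) (io a0) (eP) (ws) => x1 x2 x3 x4 x5 x6 x7 x8 x9 H1 H2 H3.
  have -> : x8 = x3 + x1 + x5 by rewrite -H1 subrK.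
  have -> : x9 = x1 - x2 + x4 by rewrite -H2 subrK.
  have -> : x6 = x3 + x2 + x7 by rewrite -H3 subrK.
  by apply/matrixP => ? ?; rewrite !mxE; ring.
exists mu => x; apply: (@map_mx_inj _ _ jF).
rewrite -(map_mx_Fp charE charF iota (m c _)) mP [RHS]map_mxB [in RHS]map_mxD mlE.
rewrite -tact_jF -muP.
have ePfix : tact AF x eP = eP by apply: tact_base; rewrite -io_tact PP.
rewrite !map_mxB io_tact !tactB ePfix; move: (tact AF x ws) (tact AF x (io (w c))).
move: (io (b _)) (io (w c)) (ws) (eP) => x1 x2 x3 x4 x5 x6.
by apply/matrixP => ? ?; rewrite !mxE; ring.
Qed.

End Local.
End Family.

(** * Arbitrarily many global solutions with prescribed local behaviour *)

Section Global.
Variables (S : finType) (v : S -> dvaluation k) (K : forall s, completion (v s)).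
Variables (F : forall s, sepClosure (K s)) (iota : forall s, {rmorphism E -> F s}).
Variable phi : forall s, Gal (F s) -> Gal E.
Hypothesis inf_k : infinitely_many_dvaluations k.
Hypothesis v_inequiv : forall s t, s <> t -> ~ dval_equiv (v s) (v t).
Hypothesis iota_k : forall s a, iota s (sepc_in E a) = sepc_in (F s) (compl_in (K s) a).
Hypothesis phiM : forall s, {morph @phi s : x y / (x * y)%g}.
Hypothesis phi_iota : forall s x u, iota s (phi x u) = x (iota s u).
Variable ml : forall s, Gal (F s) -> 'rV['F_p]_n.
Hypothesis mlr : forall s, exists rl, loc_const rl (@ml s).
Hypothesis mlM : forall s (x y : Gal (F s)),
  ml (x * y)%g = ml x + ml y *m R (phi x) + C (phi x) (phi y).

Lemma many_linear_solutions (N : nat) : (0 < n)%N ->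
  exists m : 'I_N -> Gal E -> 'rV['F_p]_n, [/\ injective m,
    forall i, linear_solution (m i), forall i, exists r', loc_const r' (m i) &
    forall i s, exists mu, forall x : Gal (F s),
      m i (phi x) = mu + ml x - mu *m R (phi x)].
Proof.
move=> n_gt0; pose i0 := Ordinal n_gt0; have p_gt1 := prime_gt1 (pcharf_prime chark).
have [P [Phi [b [a0 [w [m fam]]]]]] := solution_family_exists.
have [_ uPhi _ _] : [/\ P \in unitmx, Phi \in unitmx, forall s, tact A s P = P &
  Fr P = inE Phi *m P] by case: fam.
have locE : forall s, exists (d : 'rV[K s]_n) (B : nat),
    forall c : 'rV[k]_n,
      (forall i, dval_ge (compl_val (K s)) B%:Z (d 0 i - compl_in (K s) (c 0 i))) ->
    exists mu, forall x : Gal (F s), m c (phi x) = mu + ml x - mu *m R (phi x).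
  move=> s; have [rl rlP] := mlr s.
  exact: (local_match fam (@iota_k s) (@phiM s) (@phi_iota s) rlP (@mlM s)).
pose d s := sval (cid (locE s)); have /choice[B dB] := fun s => svalP (cid (locE s)).
have [u uP] := dvaluation_avoid v inf_k.
have [J0 J0P] := twisted_AS_obstruction u chark i0 uPhi.
(* The direction in which [twisted_AS_obstruction] forbids a large pole. *)
pose row0 : 'rV[k]_n := delta_mx 0 i0 *m Phi.
have /choice[D DP] : forall s, exists D : nat, forall a i, dval_ge (v s) (- D%:Z) (row0 a i).
  by move=> s; exact: dval_mx_bound.
(* [D s] absorbs the poles of [row0]; the 2 makes the error at [u] smaller than the prescribed polar
   term, whose valuation is at most 1. *)
pose M := (\max_s (B s + D s) + 2)%N.
have MP s : (B s + D s <= M)%N.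
  by rewrite /M (leq_trans _ (leq_addr _ _)) // (leq_bigmax (F := fun s => (B s + D s)%N)).
have [c0 c0P] : exists c0 : 'rV[k]_n, forall s i,
    dval_ge (compl_val (K s)) (B s)%:Z (compl_in (K s) (c0 0 i) - d s 0 i).
  suff /choice[c0 c0P] : forall i : 'I_n, exists c, forall s,
      dval_ge (compl_val (K s)) (B s)%:Z (compl_in (K s) c - d s 0 i).
    by exists (\row_i c0 i) => s i; rewrite mxE.
  move=> i; have /choice[t tP] := fun s => compl_dense (d s 0 i) M%:Z.
  have [c cP] := weak_approximation v_inequiv t M%:Z.
  exists c => s; rewrite -(subrK (compl_in (K s) (t s)) (compl_in _ c)) -addrA.
  have BM : (B s)%:Z <= M%:Z by rewrite lez_nat (leq_trans (leq_addr (D s) _)).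
  apply: dval_geW BM _; apply: dval_geD => //; rewrite -rmorphB.
  exact: compl_dval_ge.
pose vv (o : option S) := if o is Some s then v s else u.
have vvP o o' : o <> o' -> ~ dval_equiv (vv o) (vv o').
  case: o o' => [s|] [s'|] //= ss'.
  - by apply: v_inequiv => E'; apply: ss'; rewrite E'.
  - by move=> E'; apply: (uP s) => x x0; rewrite E'.
have /choice[eps epsP] : forall i : 'I_N, exists e : k,
    [/\ e != 0, u e = 1 - (p * (J0 + i))%N%:Z & forall s, dval_ge (v s) M%:Z e].
  move=> i; have [t t0 ut] := dval_surj u (1 - (p * (J0 + i))%N%:Z).
  have [e eP] := weak_approximation vvP (fun o => if o is Some _ then 0 else t) M%:Z.
  have [|e0 ue] := @dvalDl _ u t (e - t) t0.
    by apply: dval_geW (eP None); rewrite ut /M; lia.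
  move: e0 ue; rewrite addrC subrK ut => e0 ue; exists e; split=> // s.
  by have := eP (Some s); rewrite subr0.
pose c i := c0 + eps i *: row0.
exists (fun i => m (c i)); split.
- suff inj (i i' : 'I_N) : (i < i')%N -> m (c i') <> m (c i).
    by move=> i i' /= cc; apply/val_inj; case: (ltngtP i i') => // /inj []; rewrite cc.
  move=> ii' /(family_eq fam)[y yE].
  have [e0 ue _] := epsP i; have [e0' ue' _] := epsP i'.
  (* The larger index has the worse pole, which the difference inherits. *)
  have [|h0 uh] := @dvalDl _ u (eps i') (- eps i) e0'.
    apply: dval_geN; right; rewrite ue ue'.
    have : (p * (J0 + i) + 1 <= p * (J0 + i'))%N.
      by rewrite addn1 ltn_mul2l (ltnW p_gt1) ltn_add2l.
    by lia.
  apply: (J0P (J0 + i')%N (eps i' - eps i) y) => //; first exact: leq_addr.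
    by rewrite uh.
  rewrite -yE /c -/row0; move: (row0) => x.
  by apply/matrixP => ? ?; rewrite !mxE; ring.
- by move=> i; exact: family_solution fam _.
- by move=> i; exact: family_loc_const fam _.
move=> i s; apply: dB => l; rewrite /c mxE rmorphD /= opprD addrA.
apply: dval_geB.
  by rewrite -opprB; apply: dval_geN.
apply: compl_dval_ge; rewrite mxE; have [_ _ es] := epsP i.
by apply: dval_geW (dval_geM (es s) (DP s 0 l)); have := MP s; lia.
Qed.

End Global.
End LinearProblem.

(** * Group extensions *)

Section EmbeddingProblem.
Variables (k : fieldType) (p : nat) (chark : p \in [pchar k]) (E : sepClosure k).
Variables (S : finType) (v : S -> dvaluation k) (K : forall s, completion (v s)).
Variables (F : forall s, sepClosure (K s)) (iota : forall s, {rmorphism E -> F s}).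
Variable phi : forall s, Gal (F s) -> Gal E.
Hypothesis inf_k : infinitely_many_dvaluations k.
Hypothesis v_inequiv : forall s t, s <> t -> ~ dval_equiv (v s) (v t).
Hypothesis iota_k : forall s a, iota s (sepc_in E a) = sepc_in (F s) (compl_in (K s) a).
Hypothesis phiM : forall s, {morph @phi s : x y / (x * y)%g}.
Hypothesis phi_iota : forall s x u, iota s (phi x u) = x (iota s u).

Local Open Scope group_scope.

(** * Minimal normal kernel, elementary abelian *)

Section Abelian.
Variables (gT : finGroupType) (Gamma M : {group gT}).
Variables (tau : Gal E -> gT) (r : seq E) (beta : forall s, Gal (F s) -> gT).
Hypotheses (abelM : p.-abelem M) (ntM : M :!=: 1) (nsM : M <| Gamma).
Hypotheses (taur : loc_const r tau) (tauG : forall s, tau s \in Gamma).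
Hypothesis tauM : forall s t, tau s * tau t * (tau (s * t))^-1 \in M.
Hypothesis betaM : forall s, {morph @beta s : x y / x * y}.
Hypothesis betar : forall s, exists rl, loc_const rl (@beta s).
Hypothesis beta_tau : forall s (x : Gal (F s)), beta x * (tau (phi x))^-1 \in M.

Let nMG : Gamma \subset 'N(M) := normal_norm nsM.
Let sMG : M \subset Gamma := normal_sub nsM.
Local Notation rV := (abelem_rV abelM ntM).
Local Notation unrV := (rVabelem abelM ntM).
Local Notation rG := (abelem_repr abelM ntM nMG).

(** M is read as a row space over 'F_p. Group conjugation acts there on the right, so s acts by
    conjugation with the inverse of [tau s], and solutions have the form m(s) tau(s). *)
Lemma many_weak_solutions (N : nat) :
  exists B : 'I_N -> Gal E -> gT, [/\ injective B, forall i, {morph B i : x y / x * y},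
    forall i, exists r', loc_const r' (B i), forall i s, B i s * (tau s)^-1 \in M &
    forall i s, exists2 mu, mu \in M &
      forall x : Gal (F s), B i (phi x) = mu * beta x * mu^-1].
Proof.
pose R s := rG (tau s)^-1.
pose C s t := rV (tau s * tau t * (tau (s * t))^-1).
pose ml s (x : Gal (F s)) := rV (beta x * (tau (phi x))^-1).
have tauVG s : (tau s)^-1 \in Gamma by rewrite groupV.
have unrVR u s : unrV (u *m R s) = tau s * unrV u * (tau s)^-1.
  by rewrite rVabelemJ // conjgE invgK mulgA.
have RM s t : R (s * t) = R t *m R s.
  rewrite /R -repr_mxM //; set c := tau s * tau t * (tau (s * t))^-1.
  have -> : (tau t)^-1 * (tau s)^-1 = (tau (s * t))^-1 * c^-1.
    by rewrite -!invMg /c mulgKV.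
  (* [tau] is multiplicative only modulo M, but the abelian group M acts trivially on itself. *)
  have cM : c^-1 \in M by rewrite groupV; exact: tauM.
  have /rkerP[cG c1] : c^-1 \in rker rG.
    rewrite rker_abelem inE (fintype.subsetP sMG) //=.
    by rewrite (fintype.subsetP (abelem_abelian abelM)).
  by rewrite repr_mxM // c1 mulmx1.
(* Local constancy of [tau (s * t)] in [s] requires control on t(r), hence on whole orbits. *)
have [rs rsP] := orbits_finite r.
have taurs : loc_const rs tau.
  by apply: loc_constW taur => x xr; exact: rsP 1 x xr.
have [|||||||m [mI mS mr mloc]] := @many_linear_solutions k p chark E _ R C rs _ _ RM
    _ _ _ S v K F iota phi inf_k v_inequiv iota_k phiM phi_iota ml _ _ N isT.
- by move=> s; apply: (repr_mx_unit rG); exact: tauVG.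
- by move=> s t st; rewrite /R (taurs s t st).
- move=> s t t' tt'; rewrite /C (taurs t t' tt') (taurs (s * t) (s * t')) // => x xr.
  by rewrite !gal_mulE tt'.
- move=> t s s' ss'; rewrite /C (taurs s s' ss') (@taur (s * t) (s' * t)) // => x xr.
  by rewrite !gal_mulE ss' // rsP.
- move=> g h q; apply: (rVabelem_inj abelM ntM).
  rewrite !rVabelemD unrVR !abelem_rV_K // !mulgA; congr (_ * _).
  by rewrite !mulgKV.
- move=> s; have [rl rlP] := betar s; exists (rl ++ map (iota s) r) => x y xy.
  rewrite /ml (rlP x y); last by move=> u ur; apply: xy; rewrite mem_cat ur.
  rewrite (@taur (phi x) (phi y)) // => u ur; apply: (fmorph_inj (iota s)).
  by rewrite !phi_iota; apply: xy; rewrite mem_cat map_f ?orbT.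
- move=> s x y; apply: (rVabelem_inj abelM ntM).
  rewrite !rVabelemD unrVR !abelem_rV_K // phiM betaM !mulgA; congr (_ * _).
  by rewrite !mulgKV.
exists (fun i s => unrV (m i s) * tau s); split.
- move=> i i' ii'; apply: mI; apply/funext => s; apply: (rVabelem_inj abelM ntM).
  by apply: (mulIg (tau s)); exact: (congr1 (fun f => f s) ii').
- move=> i s t; rewrite mS !rVabelemD unrVR abelem_rV_K // !mulgA.
  by rewrite !mulgKV.
- move=> i; have [r' r'P] := mr i; exists (r ++ r') => s t st.
  rewrite (r'P s t); last by move=> x xr; apply: st; rewrite mem_cat xr orbT.
  by rewrite (@taur s t) // => x xr; apply: st; rewrite mem_cat xr.
- by move=> i s; rewrite mulgK; exact: mem_rVabelem.
move=> i s; have [mu muP] := mloc i s; exists (unrV mu); first exact: mem_rVabelem.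
move=> x; rewrite muP !rVabelemD rVabelemN unrVR abelem_rV_K // !invMg invgK !mulgA.
by rewrite !mulgKV.
Qed.

Hypothesis minM : minnormal M Gamma.
Hypothesis tau_onto : forall g, g \in Gamma -> exists s, g * (tau s)^-1 \in M.

(* A solution whose image misses Gamma meets M trivially by minimality, hence
   is determined by tau; only finitely many solutions are of this kind. *)
Lemma proper_weak_solution : exists b : Gal E -> gT,
  [/\ {morph b : x y / x * y}, exists r', loc_const r' b,
    forall s, b s * (tau s)^-1 \in M, forall g, g \in Gamma -> exists s, b s = g &
    forall s, exists2 mu, mu \in M &
      forall x : Gal (F s), b (phi x) = mu * beta x * mu^-1].
Proof.
have [B [BI BM Br Btau Bloc]] := many_weak_solutions #|{ffun gT -> gT}|.+1.
suff [i iP] : exists i, forall g, g \in Gamma -> exists s, B i s = g by exists (B i).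
apply: contrapT => no.
have tauB i s t : tau s = tau t -> B i s = B i t.
  pose D := [set y | `[< exists s, B i s = y >]]%SET.
  have DP y : reflect (exists s, B i s = y) (y \in D) by rewrite inE; exact: asboolP.
  have gD : group_set D.
    apply/group_setP; split=> [|_ _ /DP[x <-] /DP[y <-]].
      by apply/DP; exists 1; apply: (mulgI (B i 1)); rewrite -BM !mulg1.
    by apply/DP; exists (x * y); rewrite BM.
  pose DG := Group gD; have DGE y : (y \in DG) = (y \in D) by [].
  have BD s' : B i s' \in DG by rewrite DGE; apply/DP; exists s'.
  have decomp g : g \in Gamma -> exists s' a, a \in M /\ g = a * B i s'.
    move=> gG; have [s' s'P] := tau_onto gG; exists s'.
    exists (g * (tau s')^-1 * (B i s' * (tau s')^-1)^-1); split.
      by rewrite groupM // groupV; exact: Btau.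
    by rewrite invMg invgK mulgA mulgKV mulgKV.
  have [H1|ntH] := eqVneq (DG :&: M) 1.
    move=> tst; have : B i s * (B i t)^-1 \in DG :&: M.
      rewrite inE; apply/andP; split; first by rewrite groupM // groupV.
      have -> : B i s * (B i t)^-1 = (B i s * (tau s)^-1) * (B i t * (tau t)^-1)^-1.
        by rewrite tst invMg invgK mulgA mulgKV.
      by rewrite groupM ?groupV ?Btau.
    by rewrite H1 => /set1gP/eqP; rewrite -eq_mulgV1 => /eqP.
  exfalso; apply: no; exists i => g gG.
  (* The intersection is normalized by the image and, M being abelian, by M; these generate Gamma by
     [decomp], so minimality applies. *)
  have HM : DG :&: M = M.
    have /mingroupP[_ minP] := minM; apply: (minP [group of DG :&: M]).
      rewrite ntH; apply/fintype.subsetP => x xG; rewrite inE.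
      apply/fintype.subsetP => _ /imsetP[h /finset.setIP[hD hM] ->].
      have hxM : h ^ x \in M by rewrite memJ_norm ?(fintype.subsetP nMG).
      rewrite inE hxM andbT.
      have [s' [a [aM ->]]] := decomp x xG; rewrite conjgM.
      have -> : h ^ a = h.
        by rewrite conjgE (centsP (abelem_abelian abelM) h hM a aM) mulKg.
      by rewrite groupJ.
    exact: finset.subsetIr.
  apply/DP; have [s' [a [aM ->]]] := decomp g gG.
  by rewrite -DGE groupM //; move: aM; rewrite -HM inE => /andP[].
have /choice[l lP] : forall y, exists s, (exists t, tau t = y) -> tau s = y.
  move=> y; have [[t tP]|not] := pselect (exists t, tau t = y); first by exists t.
  by exists 1.
have : injective (fun i => [ffun y => B i (l y)]).
  move=> i i' /ffunP ii'; apply: BI; apply/funext => s.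
  have sl : tau s = tau (l (tau s)) by rewrite lP //; exists s.
  by have := ii' (tau s); rewrite !ffunE -!(tauB _ _ _ sl).
by move/leq_card; rewrite card_ord ltnn.
Qed.

End Abelian.

Lemma mem_of_coset (gT : finGroupType) (M H : {group gT}) x :
  M <| H -> x \in 'N(M) -> coset M x \in H / M -> x \in H.
Proof. by move=> nsM nMx xH; rewrite -(quotientGK nsM) mem_morphpre. Qed.

Lemma coset_morphV (gT : finGroupType) (M : {group gT}) x :
  x \in 'N(M) -> coset M x^-1 = (coset M x)^-1.
Proof. exact: morphV. Qed.

Lemma coset_eq_mem (gT : finGroupType) (M : {group gT}) x y :
  x \in 'N(M) -> y \in 'N(M) -> coset M x = coset M y -> x * y^-1 \in M.
Proof.
move=> nx ny xy; apply: coset_idr; first by rewrite groupM ?groupV.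
by rewrite coset_morphM ?groupV // coset_morphV // xy mulgV.
Qed.

(** Induction on the order of H through Gamma / M. The quotient map is encoded by a set-theoretic
    lift [tau] with conditions modulo H, a form that passes to Gamma / M with no separate target
    group. *)
Theorem proper_solution_mod (gT : finGroupType) (Gamma H : {group gT})
    (tau : Gal E -> gT) (beta : forall s, Gal (F s) -> gT) :
  p.-group H -> H <| Gamma ->
  (exists r, loc_const r tau) -> (forall s, tau s \in Gamma) ->
  (forall s t, tau s * tau t * (tau (s * t))^-1 \in H) ->
  (forall g, g \in Gamma -> exists s, g * (tau s)^-1 \in H) ->
  (forall s, {morph @beta s : x y / x * y}) ->
  (forall s, exists rl, loc_const rl (@beta s)) ->
  (forall s (x : Gal (F s)), beta s x * (tau (phi x))^-1 \in H) ->
  exists (b : Gal E -> gT) (n_ : S -> gT),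
    [/\ {morph b : x y / x * y} /\ (exists r, loc_const r b),
      forall s, b s * (tau s)^-1 \in H, forall g, g \in Gamma -> exists s, b s = g,
      forall s, n_ s \in H &
      forall s (x : Gal (F s)), b (phi x) = n_ s * beta s x * (n_ s)^-1].
Proof.
have [c] := ubnP #|H|; elim: c gT Gamma H tau beta => // c IH gT Gamma H tau beta.
rewrite ltnS => Hc pH nsH taur tauG tauM tau_onto betaM betar beta_tau.
have [H1|ntH] := eqVneq (H : {set gT}) 1.
  have H1P x y : x * y^-1 \in H -> x = y.
    by rewrite H1 => /set1gP/eqP; rewrite -eq_mulgV1 => /eqP.
  exists tau, (fun=> 1); split=> //.
  - by split=> // s t; apply/esym/H1P.
  - by move=> s; rewrite mulgV group1.
  - by move=> g /tau_onto[s /H1P ->]; exists s.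
  by move=> s x; rewrite mul1g invg1 mulg1; apply/esym/H1P.
have [nHG sHG] := (normal_norm nsH, normal_sub nsH).
have [M minM sMH] := minnormal_exists ntH nHG.
have [nMG ntM abM] := minnormal_solvable minM sMH (pgroup_sol pH).
have abelM : p.-abelem M by rewrite -(is_abelem_pgroup (pgroupS sMH pH)).
have sMG : M \subset Gamma := fintype.subset_trans sMH sHG.
have nsMG : M <| Gamma by rewrite /normal sMG nMG.
have nsMH : M <| H by rewrite /normal sMH (fintype.subset_trans sHG nMG).
have GN x : x \in Gamma -> x \in 'N(M) by exact: (fintype.subsetP nMG).
have HG x : x \in H -> x \in Gamma by exact: (fintype.subsetP sHG).
have betaG s x : beta s x \in Gamma.
  by rewrite -[beta s x](mulgKV (tau (phi x))) groupM // HG.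
have [||||||||||bb [nb [[bbM [rb bbr]] bb_tau bb_onto nbH bb_loc]]] :=
  IH _ (Gamma / M)%G (H / M)%G (fun s => coset M (tau s)) (fun s x => coset M (beta s x)).
- by apply: leq_trans Hc; exact: ltn_quotient.
- exact: quotient_pgroup.
- exact: quotient_normal.
- by have [r rP] := taur; exists r => s t /rP ->.
- by move=> s; exact: mem_quotient.
- move=> s t; rewrite -coset_morphV -?coset_morphM ?groupM ?groupV ?GN //; exact: mem_quotient.
- move=> _ /morphimP[g Ng gG ->]; have [s sP] := tau_onto g gG; exists s.
  by rewrite -coset_morphV -?coset_morphM ?groupV ?GN //; exact: mem_quotient.
- by move=> s x y; rewrite betaM coset_morphM ?GN.
- by move=> s; have [rl rP] := betar s; exists rl => x y /rP ->.
- by move=> s x; rewrite -coset_morphV -?coset_morphM ?groupV ?GN //; exact: mem_quotient.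
have bbG s : bb s \in Gamma / M.
  rewrite -[bb s](mulgKV (coset M (tau s))) groupM ?mem_quotient //.
  by apply: (fintype.subsetP (quotientS M sHG)); exact: bb_tau.
(* The solution modulo M, lifted to Gamma, becomes the new [tau]; it stays locally constant because
   it depends only on [bb s]. *)
pose tau' s := repr (bb s).
have tau'K s : coset M (tau' s) = bb s by rewrite /tau' coset_reprK.
have tau'G s : tau' s \in Gamma.
  by apply: mem_of_coset nsMG (repr_coset_norm _) _; rewrite tau'K.
have /choice[n' n'P] : forall s, exists n', n' \in H /\ coset M n' = nb s.
  by move=> s; have /morphimP[x Nx xH ->] := nbH s; exists x.
have n'H s : n' s \in H by have [] := n'P s.
have n'K s : coset M (n' s) = nb s by have [] := n'P s.
(* Conjugating by lifts of the [nb s] makes the local solutions agree with [tau'] modulo M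
   exactly. *)
pose beta' s x := n' s * beta s x * (n' s)^-1.
have [||||||b [bM br b_tau b_onto b_loc]] :=
    @proper_weak_solution _ Gamma M tau' rb beta' abelM ntM nsMG _ tau'G _ _ _ _ minM.
- by move=> s t st; rewrite /tau' (bbr _ _ st).
- move=> s t; apply: coset_eq_mem; rewrite ?GN ?groupM //.
  by rewrite coset_morphM ?GN // !tau'K bbM.
- by move=> s x y; rewrite /beta' betaM !mulgA mulgKV.
- by move=> s; have [rl rP] := betar s; exists rl => x y /rP E'; rewrite /beta' E'.
- move=> s x; have nG := HG _ (n'H s).
  apply: coset_eq_mem; rewrite ?GN ?groupM ?groupV //.
  have [nN bN] := (GN _ nG, GN _ (betaG s x)).
  rewrite /beta' coset_morphM ?groupM ?groupV // coset_morphM // coset_morphV //.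
  by rewrite tau'K bb_loc n'K.
- move=> g gG; have [s sP] := bb_onto _ (mem_quotient M gG); exists s.
  by apply: coset_eq_mem; rewrite ?GN // tau'K sP.
have /choice[mu muP] : forall s, exists mu, mu \in M /\
    forall x : Gal (F s), b (phi x) = mu * beta' s x * mu^-1.
  by move=> s; have [mu] := b_loc s; exists mu.
have bG s : b s \in Gamma.
  by rewrite -[b s](mulgKV (tau' s)) groupM // (fintype.subsetP sMG).
have bK s : coset M (b s) = bb s.
  rewrite -[b s](mulgKV (tau' s)) coset_morphM ?GN ?groupM ?groupV //.
  by rewrite tau'K coset_id // mul1g.
exists b, (fun s => mu s * n' s); split=> //.
- move=> s; apply: (mem_of_coset nsMH); first by rewrite GN // groupM ?groupV.
  by rewrite coset_morphM ?groupV ?GN // coset_morphV ?GN // bK; exact: bb_tau.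
- by move=> s; have [muM _] := muP s; rewrite groupM // (fintype.subsetP sMH).
by move=> s x; have [_ ->] := muP s; rewrite /beta' invMg !mulgA.
Qed.

End EmbeddingProblem.

(** * Krull continuity and the embedding problem *)

Lemma continuous_loc_const (k : fieldType) (E : sepClosure k) (gT : finGroupType)
    (f : Gal E -> gT) : {morph f : x y / (x * y)%g} ->
  continuous (f : Gal E -> discrete_topology gT) -> exists r, loc_const r f.
Proof.
move=> fM /(_ 1%g) fc.
have /nbhs_krullP[r rP] := fc _ (discrete_set1 (f 1%g : discrete_topology gT)).
exists r => s t st.
have /= f1 : f (s^-1 * t)%g = f 1%g.
  by apply: rP => x xr; rewrite gal_mulE -st //; exact/esym/(gal_funK s).
by rewrite -[t](mulKVg s) fM f1 -fM mulg1.
Qed.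

Lemma loc_const_continuous (k : fieldType) (E : sepClosure k) (gT : finGroupType)
    (r : seq E) (f : Gal E -> gT) : loc_const r f ->
  continuous (f : Gal E -> discrete_topology gT).
Proof.
move=> fr s B /nbhs_singleton Bs; apply/nbhs_krullP; exists r => t st /=.
by rewrite -(fr s t st).
Qed.

(* phi s is the map sigma |-> sigma|_ksep attached to the embedding iota s of
   ksep into the separable closure of the completion. *)
Theorem theorem2p4 (k : fieldType) (p : nat) (char_k : p \in [pchar k]%R)
    (inf_k : infinitely_many_dvaluations k)
    (ksep : sepClosure k)
    (S : finType) (v : S -> dvaluation k)
    (v_inequiv : forall s t : S, s <> t -> ~ dval_equiv (v s) (v t))
    (kv : forall s : S, completion (v s))
    (kvsep : forall s : S, sepClosure (kv s))
    (iota : forall s : S, {rmorphism ksep -> kvsep s}%R)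
    (iota_k : forall (s : S) (a : k),
      iota s (sepc_in ksep a) = sepc_in (kvsep s) (compl_in (kv s) a))
    (phi : forall s : S, profiniteHom (Gal (kvsep s)) (Gal ksep))
    (phi_iota : forall (s : S) (sigma : Gal (kvsep s)) (x : ksep),
      iota s (phi s sigma x) = sigma (iota s x))
    (E : finEmbeddingProblem (Gal ksep))
    (pE : (p.-group (ep_ker E))%g) :
  properly_solvable phi E.
Proof.
Local Open Scope group_scope.
move=> beta_ beta_sol.
have [alr alrP] : exists r, loc_const r (ep_alpha E).
  exact: continuous_loc_const (@ep_alphaM _ E) (@ep_alpha_continuous _ E).
have alG x : ep_alpha E x \in ep_G E.
  have : range (ep_alpha E) (ep_alpha E x) by exists x.
  by rewrite ep_alpha_onto.
(* A set-theoretic section of [ep_f], with the placeholder 1 outside [ep_G]; composed with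
   [ep_alpha] it gives a locally constant lift. *)
have /choice[l lP] : forall h, exists g, h \in ep_G E -> g \in ep_Gamma E /\ ep_f E g = h.
  move=> h; have [hG|hG] := boolP (h \in ep_G E); last by exists 1.
  by move: hG; rewrite -{1}(ep_f_onto E) => /morphimP[g _ gG ->]; exists g.
pose tau s := l (ep_alpha E s).
have tauG s : tau s \in ep_Gamma E by have [] := lP _ (alG s).
have tauK s : ep_f E (tau s) = ep_alpha E s by have [] := lP _ (alG s).
have kerP' x y : x \in ep_Gamma E -> y \in ep_Gamma E -> ep_f E x = ep_f E y ->
    x * y^-1 \in ep_ker E.
  move=> xG yG xy; apply/kerP; first by rewrite groupM ?groupV.
  by rewrite morphM ?groupV // morphV // xy mulgV.
have betaP s x : beta_ s x \in ep_Gamma E /\ ep_f E (beta_ s x) = ep_alpha E (phi s x).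
  have [_ _ bG bf] := beta_sol s; split; last exact: bf.
  exact: (fintype.subsetP (pullback_Gamma_sub (phi s) E)).
have [||||||b [n_ [[bM [r rP]] b_tau b_onto nH b_loc]]] :=
  @proper_solution_mod k p char_k ksep S v kv kvsep iota (fun s x => phi s x) inf_k
    v_inequiv iota_k (fun s => @phomM _ _ (phi s)) phi_iota _ (ep_Gamma E) (ep_ker E)
    tau beta_ pE (ker_normal _) _ tauG.
- by exists alr => s t st; rewrite /tau (alrP s t st).
- move=> s t; apply: kerP'; rewrite ?groupM //.
  by rewrite morphM // !tauK ep_alphaM.
- move=> g gG; have : ep_f E g \in ep_G E by rewrite -(ep_f_onto E) mem_morphim.
  have := ep_alpha_onto E => /seteqP[_ H] /H[s _ sP]; exists s.
  by apply: kerP' => //; rewrite tauK.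
- by move=> s; have [] := beta_sol s.
- move=> s; have [sM sc _ _] := beta_sol s; exact: continuous_loc_const sM sc.
- by move=> s x; have [bG bf] := betaP s x; apply: kerP' => //; rewrite tauK.
have bG s : b s \in ep_Gamma E.
  rewrite -[b s](mulgKV (tau s)) groupM //.
  by have := b_tau s; apply: (fintype.subsetP (normal_sub (ker_normal (ep_f E)))).
exists b, n_; split=> //; split=> //; split=> //.
  exact: loc_const_continuous rP.
move=> s; rewrite -tauK -[b s](mulgKV (tau s)) morphM //; last first.
  by rewrite groupM ?groupV.
by have /kerP -> := b_tau s; rewrite ?mul1g // groupM ?groupV.
Qed.
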